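(* Let $\alpha,\beta\in L^\infty$. (i) $\operatorname{ess\,ran}\alpha\cup\operatorname{ess\,ran}\beta\subset\Pi(S_{\alpha,\beta})$. (ii) $\sigma(S_{\alpha,0})=\sigma(T_\alpha)\cup\{0\}$ and $\sigma(S_{0,\beta})=\sigma(\tilde T_\beta)\cup\{0\}$. (iii) If $\alpha$ is analytic or $\beta$ is co-analytic, then $\sigma(S_{\alpha,\beta})\subset\sigma(T_\alpha)\cup\sigma(\tilde T_\beta)\cup\{0\}$. (iv) If $\alpha$ is analytic and $\beta$ is co-analytic, then $\sigma(S_{\alpha,\beta})\cup\{0\}=\sigma(T_\alpha)\cup\sigma(\tilde T_\beta)\cup\{0\}$.
   Context: $S^1=\{z\in\mathbb{C}:|z|=1\}$ carries normalized Lebesgue measure $m$; $L^2=L^2(S^1)$, $L^\infty=L^\infty(S^1)$ (complex-valued functions). $H^2$ is the Hardy space of all $f\in L^2$ whose negative Fourier coefficients vanish, and $H^{2\bot}$ is its orthogonal complement in $L^2$. $P$ and $Q=I-P$ are the orthogonal projections of $L^2$ onto $H^2$ and $H^{2\bot}$. For $\alpha,\beta\in L^\infty$: $S_{\alpha,\beta}$ on $L^2$ is $S_{\alpha,\beta}f=\alpha Pf+\beta Qf$; the Toeplitz operator $T_\alpha$ on $H^2$ is $T_\alpha f=P(\alpha f)$; the operator $\tilde T_\beta$ on $H^{2\bot}$ is $\tilde T_\beta f=Q(\beta f)$. A function in $L^2$ is analytic if it lies in $H^2$, and co-analytic if its complex conjugate is analytic. For a bounded operator $T$, $\sigma(T)$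 is its spectrum and $\Pi(T)$ its approximate point spectrum, i.e. the set of $\lambda\in\mathbb{C}$ for which there are unit vectors $h_n$ with $\|(T-\lambda I)h_n\|\to0$. The essential range is $\operatorname{ess\,ran}\alpha=\{\lambda\in\mathbb{C}: m\{e^{i\theta}:|\alpha(e^{i\theta})-\lambda|<\epsilon\}>0\text{ for all }\epsilon>0\}$. *)

(* Defs.v *)
From HB Require Import structures.
From mathcomp Require Import all_boot all_order all_algebra ring_quotient.
From mathcomp Require Import complex.
From mathcomp Require Import all_classical all_reals all_analysis.
From mathcomp Require Import measurable_realfun.

Set Implicit Arguments.
Unset Strict Implicit.
Unset Printing Implicit Defensive.

Import Order.TTheory GRing.Theory Num.Theory.
Import numFieldNormedType.Exports.
Import ComplexField.Normc.

Local Open Scope classical_set_scope.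
Local Open Scope complex_scope.
Local Open Scope ring_scope.

Definition circle (R : realType) : Type := {z : R[i] | normc z == 1}.

Section Circle.
Variable R : realType.

HB.instance Definition _ := Choice.on (circle R).

Lemma expi_subproof (t : R) : normc (cos t +i* sin t) == 1.
Proof. by rewrite /normc cos2Dsin2 sqrtr1. Qed.

Definition expi (t : measurableTypeR R) : circle R :=
  exist _ (cos t +i* sin t) (expi_subproof t).

HB.instance Definition _ := isPointed.Build (circle R) (expi 0).

(* As [expi] restricts to a Borel isomorphism from [0, 2pi[ onto the circle,
   the Borel subsets of the circle are the sets whose lift to R is Borel. *)
Definition circle_measurable : set (set (circle R)) :=
  [set A | measurable (expi @^-1` A)].

Lemma circle_measurable0 : circle_measurable set0.
Proof. by rewrite /circle_measurable /= preimage_set0. Qed.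

Lemma circle_measurableC A : circle_measurable A -> circle_measurable (~` A).
Proof. by rewrite /circle_measurable /= preimage_setC; exact: measurableC. Qed.

Lemma circle_measurable_bigcup (F : (set (circle R))^nat) :
  (forall k, circle_measurable (F k)) -> circle_measurable (\bigcup_k F k).
Proof.
move=> mF; rewrite /circle_measurable /= preimage_bigcup.
exact: bigcupT_measurable.
Qed.

HB.instance Definition _ := @isMeasurable.Build default_measure_display
  (circle R) circle_measurable circle_measurable0 circle_measurableC
  circle_measurable_bigcup.

Lemma measurable_expi : measurable_fun [set: measurableTypeR R] expi.
Proof. by move=> _ A mA; rewrite setTI. Qed.

HB.instance Definition _ := isMeasurableFun.Build _ _
  (measurableTypeR R) (circle R) expi measurable_expi.

Definition arc_length : set (circle R) -> \bar R :=
  pushforward (mrestr (@lebesgue_measure R) (measurable_itv `[0, 2 * pi[)) expi.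

Lemma arc_length0 : arc_length set0 = 0%E.
Proof. by rewrite /arc_length /pushforward preimage_set0 measure0. Qed.

Lemma arc_length_ge0 A : (0 <= arc_length A)%E.
Proof. exact: measure_ge0. Qed.

Lemma arc_length_sigma_additive : semi_sigma_additive arc_length.
Proof.
exact: measure_semi_sigma_additive.
Qed.

HB.instance Definition _ := isMeasure.Build _ _ _ arc_length
  arc_length0 arc_length_ge0 arc_length_sigma_additive.

Lemma invr2pi_ge0 : 0 <= (2 * pi : R)^-1.
Proof. by rewrite invr_ge0 mulr_ge0 ?pi_ge0. Qed.

Definition mcircle : {measure set (circle R) -> \bar R} :=
  mscale (NngNum invr2pi_ge0) arc_length.

End Circle.

Arguments mcircle {R}.

Lemma mcircle_setT (R : realType) : mcircle [set: circle R] = 1%E.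
Proof.
rewrite /mcircle /= /mscale /= /arc_length /pushforward /mrestr preimage_setT.
rewrite setTI lebesgue_measure_itv /= lte_fin mulr_gt0 ?pi_gt0//.
by rewrite -EFinB subr0 -EFinM mulVf// mulf_neq0// gt_eqF ?pi_gt0.
Qed.

Section Lp.
Variable R : realType.
Implicit Types (f g : circle R -> R[i]) (p : \bar R).

Definition Lp p : set (circle R -> R[i]) :=
  [set f : circle R -> R[i] |
    [/\ measurable_fun [set: circle R] (fun z => complex.Re (f z)),
        measurable_fun [set: circle R] (fun z => complex.Im (f z)) &
        finite_norm mcircle p (fun z => normc (f z))]].

Lemma normc_ge0 (x : R[i]) : 0 <= normc x.
Proof. by case: x => a b; exact: sqrtr_ge0. Qed.

Lemma measurable_normc f :
  measurable_fun [set: circle R] (fun z => complex.Re (f z)) ->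
  measurable_fun [set: circle R] (fun z => complex.Im (f z)) ->
  measurable_fun [set: circle R] (fun z => normc (f z)).
Proof.
move=> mRe mIm.
have -> : (fun z => normc (f z)) = (@powR R ^~ 2^-1) \o
    (fun z => complex.Re (f z) ^+ 2 + complex.Im (f z) ^+ 2).
  by apply/funext => z /=; rewrite powR12_sqrt ?addr_ge0 ?sqr_ge0//; case: (f z).
apply: measurableT_comp; first exact: measurable_powR.
by apply: measurable_funD; exact: measurable_funX.
Qed.

Lemma le_Lnorm2 (u v : circle R -> R) :
  measurable_fun [set: circle R] u -> measurable_fun [set: circle R] v ->
  (forall z, 0 <= u z <= v z) ->
  ('N[mcircle]_2[EFin \o u] <= 'N[mcircle]_2[EFin \o v])%E.
Proof.
move=> mu mv uv; rewrite unlock /Lnorm.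
have mn (w : circle R -> R) : measurable_fun [set: circle R] w ->
    measurable_fun [set: circle R] (fun z => `|(EFin \o w) z| `^ 2)%E.
  move=> mw; apply: (measurableT_comp (measurable_poweR _)) => //.
  by apply: measurableT_comp => //; exact/measurable_EFinP.
apply: gt0_ler_poweR; rewrite ?invr_ge0// ?in_itv/= ?leey ?andbT.
- by apply: integral_ge0 => z _; rewrite lee_fin powR_ge0.
- by apply: integral_ge0 => z _; rewrite lee_fin powR_ge0.
apply: ge0_le_integral; [by []| |exact: mn|exact: mn|].
  by move=> *; rewrite lee_fin powR_ge0.
move=> z _; have /andP[u0 uvz] := uv z.
by rewrite lee_fin ge0_ler_powR// ?nnegrE// !ger0_norm// (le_trans u0).
Qed.

Lemma Lp2_Lfun f : Lp 2%:E f -> (fun z => normc (f z)) \in Lfun mcircle 2%:E.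
Proof.
case=> mRe mIm fin; apply/andP; split; rewrite inE//.
exact: measurable_normc.
Qed.

Lemma Lnorm2Z (a : R[i]) f : Lp 2%:E f ->
  ('N[mcircle]_2[EFin \o (fun z => normc ((a *: f) z))] =
   (normc a)%:E * 'N[mcircle]_2[EFin \o (fun z => normc (f z))])%E.
Proof.
move=> /Lp2_Lfun fL.
have p1 : (1 <= 2%:E :> \bar R)%E by rewrite lee_fin ler1n.
have := LnormZ (Lfun_Sub p1 fL) (normc a).
rewrite ger0_norm ?normc_ge0// => <-.
by apply: eq_Lnorm => z /=; rewrite normcM.
Qed.

Lemma Lnorm2D f g : Lp 2%:E f -> Lp 2%:E g ->
  ('N[mcircle]_2[EFin \o (fun z => normc ((f + g)%R z))] <=
   'N[mcircle]_2[EFin \o (fun z => normc (f z))] +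
   'N[mcircle]_2[EFin \o (fun z => normc (g z))])%E.
Proof.
move=> [fRe fIm _] [gRe gIm _].
have mf := measurable_normc fRe fIm; have mg := measurable_normc gRe gIm.
apply: (le_trans _ (eminkowski _ mf mg _)); last by rewrite lee_fin ler1n.
apply: le_Lnorm2; [|exact: measurable_funD|].
- apply: measurable_normc.
  + have -> : (fun z => complex.Re ((f + g) z)) =
      (fun z => complex.Re (f z)) \+ (fun z => complex.Re (g z)).
      by apply/funext => z /=; rewrite -raddfD.
    exact: measurable_funD.
  + have -> : (fun z => complex.Im ((f + g) z)) =
      (fun z => complex.Im (f z)) \+ (fun z => complex.Im (g z)).
      by apply/funext => z /=; rewrite -raddfD.
    exact: measurable_funD.
- by move=> z; rewrite normc_ge0 /= le_normcD.
Qed.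

Definition L2fun_pred : {pred circle R -> R[i]} := fun f => `[< Lp 2%:E f >].

Lemma L2fun_submod_closed : submod_closed L2fun_pred.
Proof.
have Z a f : Lp 2%:E f -> Lp 2%:E (a *: f).
  move=> Lf; have [fRe fIm ff] := Lf; split.
  - have -> : (fun z => complex.Re ((a *: f) z)) =
      (fun z => complex.Re a * complex.Re (f z) - complex.Im a * complex.Im (f z)).
      by apply/funext => z; rewrite /GRing.scale/=; case: a (f z) => a b [].
    by apply: measurable_funB; exact: measurable_funM.
  - have -> : (fun z => complex.Im ((a *: f) z)) =
      (fun z => complex.Re a * complex.Im (f z) + complex.Im a * complex.Re (f z)).
      by apply/funext => z; rewrite /GRing.scale/=; case: a (f z) => a b [].
    by apply: measurable_funD; exact: measurable_funM.
  - by rewrite /finite_norm Lnorm2Z// lte_mul_pinfty ?lee_fin ?normc_ge0.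
split.
  apply/asboolP; split => /=; [exact: measurable_cst..|].
  rewrite /finite_norm (_ : _ \o _ = cst 0%E).
    by rewrite Lnorm0// eqe pnatr_eq0.
  by apply/funext => z /=; congr EFin; exact: normc0.
move=> a f g /asboolP/(Z a) Lf /asboolP Lg; apply/asboolP.
have [fRe fIm ff] := Lf; have [gRe gIm gf] := Lg; split.
- have -> : (fun z => complex.Re ((a *: f + g) z)) =
      (fun z => complex.Re ((a *: f) z)) \+ (fun z => complex.Re (g z)).
    by apply/funext => z /=; rewrite -raddfD.
  exact: measurable_funD.
- have -> : (fun z => complex.Im ((a *: f + g) z)) =
      (fun z => complex.Im ((a *: f) z)) \+ (fun z => complex.Im (g z)).
    by apply/funext => z /=; rewrite -raddfD.
  exact: measurable_funD.
- apply: (le_lt_trans (Lnorm2D Lf Lg)); exact: lte_add_pinfty.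
Qed.

HB.instance Definition _ := GRing.isSubmodClosed.Build _ _ L2fun_pred
  L2fun_submod_closed.

Definition L2fun : Type := {f : circle R -> R[i] | f \in L2fun_pred}.
HB.instance Definition _ := SubChoice.on L2fun.
HB.instance Definition _ := [SubChoice_isSubLmodule of L2fun by <:].

Definition ae_null : {pred L2fun} :=
  fun u => `[< {ae mcircle, forall z, val u z = 0} >].

Lemma ae_null_zmod_closed : zmod_closed ae_null.
Proof.
split; first by apply/asboolP; exact: nearW.
move=> u v /asboolP u0 /asboolP v0; apply/asboolP.
apply: filterS2 u0 v0 => z uz vz.
by rewrite raddfB /= [LHS](_ : _ = val u z - val v z)// uz vz subrr.
Qed.

HB.instance Definition _ := GRing.isZmodClosed.Build _ ae_null
  ae_null_zmod_closed.

Local Open Scope quotient_scope.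

Definition L2 : Type := Quotient.quot ae_null.

HB.instance Definition _ := GRing.Zmodule.on L2.
HB.instance Definition _ := EqQuotient.on L2.

Lemma L2_eqP (u v : L2fun) :
  reflect {ae mcircle, forall z, val u z = val v z} (u == v %[mod L2]).
Proof.
rewrite -Quotient.idealrBE unfold_in /ae_null.
apply: (iffP (asboolP _)); apply: filterS => z.
  rewrite raddfB /= => /eqP.
  by rewrite [X in X == _](_ : _ = val u z - val v z)// subr_eq0 => /eqP.
by move=> uv; rewrite raddfB /= [LHS](_ : _ = val u z - val v z)// uv subrr.
Qed.

Definition L2_scale (a : R[i]) (x : L2) : L2 := \pi_L2 (a *: repr x).

Lemma pi_L2_scale a (u : L2fun) : L2_scale a (\pi_L2 u) = \pi_L2 (a *: u).
Proof.
apply/eqP/L2_eqP; have := reprK (\pi_L2 u) => /eqP/L2_eqP.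
apply: filterS => z; rewrite !linearZ /= => uz.
exact: (congr1 (fun t => a * t) uz).
Qed.

Lemma L2_scaleA a b x : L2_scale a (L2_scale b x) = L2_scale (a * b) x.
Proof. by rewrite -[x]reprK (pi_L2_scale b) !pi_L2_scale scalerA. Qed.

Lemma L2_scale1 : left_id 1 L2_scale.
Proof. by move=> x; rewrite -[x]reprK pi_L2_scale scale1r. Qed.

Lemma pi_L2D (u v : L2fun) : \pi_L2 (u + v) = \pi_L2 u + \pi_L2 v.
Proof. exact: (Quotient.pi_add ae_null). Qed.

Lemma L2_scaleDr : right_distributive L2_scale +%R.
Proof.
move=> a x y; rewrite -[x]reprK -[y]reprK -pi_L2D.
by rewrite [LHS]pi_L2_scale scalerDr pi_L2D -!pi_L2_scale.
Qed.

Lemma L2_scaleDl x : {morph L2_scale^~ x : a b / a + b}.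
Proof.
move=> a b; rewrite -[x]reprK.
by rewrite [LHS]pi_L2_scale scalerDl pi_L2D -!pi_L2_scale.
Qed.

HB.instance Definition _ := GRing.Zmodule_isLmodule.Build R[i] L2
  L2_scaleA L2_scale1 L2_scaleDr L2_scaleDl.

(* Values of a representative chosen by the quotient: meaningful only up to
   almost-everywhere equality. *)
Definition L2_val (x : L2) : circle R -> R[i] := val (repr x).

Coercion L2_val : L2 >-> Funclass.

Definition L2_norm (x : L2) : R :=
  fine 'N[mcircle]_2[EFin \o (fun z => normc (x z))].

Lemma L2_valP (x : L2) : Lp 2%:E x.
Proof. exact/asboolP/(valP (repr x)). Qed.

Lemma L2_normE (x : L2) :
  (L2_norm x)%:E = ('N[mcircle]_2[EFin \o (fun z => normc (x z))])%E.
Proof.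
have [_ _ fin] := L2_valP x.
by rewrite fineK// fin_numElt (lt_le_trans ltNy0) ?Lnorm_ge0.
Qed.

Lemma L2_val_pi (u : L2fun) : {ae mcircle, forall z, (\pi_L2 u : L2) z = val u z}.
Proof. by apply/L2_eqP; rewrite reprK. Qed.

Lemma L2_norm_pi (u : L2fun) :
  (L2_norm (\pi_L2 u))%:E = ('N[mcircle]_2[EFin \o (fun z => normc (val u z))])%E.
Proof.
have mE (v : L2fun) : measurable_fun [set: circle R]
    (fun z => `|(EFin \o (fun z => normc (val v z))) z| `^ 2)%E.
  have [mRe mIm _] : Lp 2%:E (val v) by apply/asboolP/(valP v).
  apply: (measurableT_comp (measurable_poweR _)) => //.
  apply: measurableT_comp => //; apply/measurable_EFinP.
  exact: measurable_normc.
rewrite L2_normE unlock /Lnorm; congr (_ `^ _)%E.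
apply: ae_eq_integral => //; [exact: mE..|].
by apply: filterS (L2_val_pi u) => z /= -> _.
Qed.

Lemma L2_norm_scale (a : R[i]) x : L2_norm (a *: x) = normc a * L2_norm x.
Proof.
apply/EFin_inj; rewrite -[x]reprK.
rewrite [a *: _](pi_L2_scale a (repr x)) EFinM !L2_norm_pi linearZ /=.
by rewrite Lnorm2Z//; exact: L2_valP.
Qed.

Lemma L2_norm_ler_add x y : L2_norm (x + y) <= L2_norm x + L2_norm y.
Proof.
rewrite -lee_fin EFinD -[x]reprK -[y]reprK -pi_L2D !L2_norm_pi raddfD /=.
by apply: Lnorm2D; exact: L2_valP.
Qed.

Lemma pi_L20 : \pi_L2 0 = 0.
Proof. by apply: (addrI (\pi_L2 0)); rewrite -pi_L2D !addr0. Qed.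

Lemma L2_norm_eq0 x : L2_norm x = 0 -> x = 0.
Proof.
move=> x0; have := L2_normE x; rewrite x0 => /esym /Lnorm_eq0_eq0 ae0.
have [mRe mIm _] := L2_valP x.
rewrite -[x]reprK -pi_L20; apply/eqP/L2_eqP.
have : (\forall z \ae mcircle, [set: circle R] z -> (normc (x z))%:E = 0%E).
  by apply: ae0; [apply/measurable_EFinP; exact: measurable_normc|rewrite lte_fin].
by apply: filterS => z /(_ I) [] /eq0_normc.
Qed.

Lemma L2_normMn x n : L2_norm (x *+ n) = L2_norm x *+ n.
Proof.
by rewrite -scaler_nat L2_norm_scale normcMn normc1 mulr_natl.
Qed.

Lemma L2_normN x : L2_norm (- x) = L2_norm x.
Proof. by rewrite -scaleN1r L2_norm_scale normcN normc1 mul1r. Qed.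

HB.instance Definition _ := Num.Zmodule_isNormed.Build R L2
  L2_norm_ler_add L2_norm_eq0 L2_normMn L2_normN.

End Lp.

Arguments L2 : clear implicits.

Section Hardy.
Variable R : realType.
Implicit Types (f : circle R -> R[i]) (x y : L2 R) (V : set (L2 R)).

(* The class of [f] in L^2 (0 if [f] is not square-integrable). *)
Definition toL2 f : L2 R := (\pi_(L2 R) (insubd (0 : L2fun R) f))%qT.

Definition cintegral f : R[i] :=
  (\int[mcircle]_z complex.Re (f z)) +i* (\int[mcircle]_z complex.Im (f z)).

Definition inner x y : R[i] := cintegral (fun z => x z * conjc (y z)).

Definition fourier x (n : int) : R[i] :=
  cintegral (fun z => x z * sval z ^ (- n)).

Definition H2 : set (L2 R) := [set x | forall n : int, n < 0 -> fourier x n = 0].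

Definition orthogonal_compl V : set (L2 R) :=
  [set x | forall y, V y -> inner x y = 0].

Definition H2perp : set (L2 R) := orthogonal_compl H2.

(* The orthogonal projection onto a closed subspace [V]: the unique [y] in [V]
   with [x - y] orthogonal to [V]. *)
Definition orthogonal_proj V x : L2 R :=
  xget 0 [set y | V y /\ orthogonal_compl V (x - y)].

Definition projH2 x : L2 R := orthogonal_proj H2 x.

Definition projH2perp x : L2 R := x - projH2 x.

Definition analytic f : Prop := Lp 2%:E f /\ H2 (toL2 f).

Definition coanalytic f : Prop := analytic (fun z => conjc (f z)).

Definition mulL2 f x : L2 R := toL2 (fun z => f z * x z).

Definition essran f : set R[i] :=
  [set l | forall e : R, 0 < e -> (0 < mcircle [set z | (normc (f z - l) < e)%R])%E].

End Hardy.

Section Spectrum.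
Variable R : realType.
Implicit Types (V : set (L2 R)) (T S : L2 R -> L2 R).

(* An operator on a closed subspace [V] is represented by a function on L^2 of
   which only the restriction to [V] matters. *)
Definition bounded_operator V T : Prop :=
  [/\ forall x, V x -> V (T x),
      forall (a : R[i]) x y, V x -> V y -> T (a *: x + y) = a *: T x + T y &
      exists k : R, forall x, V x -> `|T x| <= k * `|x|].

Definition invertible V T : Prop :=
  exists2 S, bounded_operator V S &
    forall x, V x -> S (T x) = x /\ T (S x) = x.

Definition spectrum V T : set R[i] :=
  [set l | ~ invertible V (fun x => T x - l *: x)].

Definition approx_spectrum V T : set R[i] :=
  [set l | exists h : nat -> L2 R,
    (forall n, V (h n) /\ `|h n| = 1) /\
    `|T (h n) - l *: h n| @[n --> \oo] --> (0 : R)].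

End Spectrum.

Section Operators.
Variable R : realType.
Implicit Types (a b : circle R -> R[i]) (x : L2 R).

Definition singular_op a b x : L2 R := mulL2 a (projH2 x) + mulL2 b (projH2perp x).

(* To be read as an operator on [H2]. *)
Definition toeplitz a x : L2 R := projH2 (mulL2 a x).

(* To be read as an operator on [H2perp]. *)
Definition co_toeplitz b x : L2 R := projH2perp (mulL2 b x).

End Operators.

(* Main.v *)
(** On [L^2 = H^2 + H^2perp] the operator [S_{alpha,beta} - l] is a 2x2 block
    matrix with diagonal blocks [T_alpha - l] and [T~_beta - l].  It is triangular
    as soon as [alpha] is analytic or [beta] is co-analytic, and diagonal if both
    hold; for [beta = 0] it is triangular with second diagonal block [- l].
    Parts (ii)-(iv) are the inversion of such matrices.  For (i), an
    indicator function concentrated where [alpha] is close to [l] is approximated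
    by a trigonometric polynomial [p]; since multiplication by [z^N] is an isometry
    commuting with multiplication by [alpha - l], the vectors [z^N p] in [H^2] and
    [z^-N p] in [H^2perp] are approximate eigenvectors.

    The projections exist because [L^2] is complete and the exponentials form a
    complete orthonormal system.  For the latter, let [g] have vanishing Fourier
    coefficients.  Then so does [f g] for every trigonometric polynomial [f],
    hence for every bounded pointwise limit of such, in particular for the
    indicator of an arc.  So [g] has integral zero over every arc and vanishes by
    Lebesgue's differentiation theorem. *)
Require Import Defs.
From mathcomp Require Import all_boot all_order all_algebra.
From mathcomp Require Import complex.
From mathcomp Require Import all_classical all_reals all_analysis.
From mathcomp Require Import measurable_realfun ring lra.
Import Order.TTheory GRing.Theory Num.Theory.
Import numFieldNormedType.Exports.
Import ComplexField.Normc.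
Local Open Scope classical_set_scope.
Local Open Scope complex_scope.
Local Open Scope ring_scope.
Set Implicit Arguments.
Unset Strict Implicit.
Unset Printing Implicit Defensive.

(** An invertible triangular block operator can have singular diagonal blocks: multiplication by z
    is invertible on L^2, although its compressions to [H2] and to [H2perp] are not. Triangularity
    alone therefore yields only the inclusion (iii). For the equalities the inverse, too, has to
    leave the invariant subspace stable: in (ii) because the shifted operator is a non-zero scalar
    there when l is not 0, in (iv) because the operator is diagonal.

    In (i) the shift by z^N removes the projections, since S_{alpha,beta} is plain multiplication by
    alpha on [H2] and by beta on [H2perp]. One shift brings a vector into [H2] only if its
    frequencies are bounded below, hence the passage to trigonometric polynomials.

    [orthogonal_proj] is a choice with default 0: nothing is known of the projection until a
    decomposition of each vector is exhibited. Vectors are classes with a chosen representative;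
    identities between them are checked almost everywhere and brought back to the quotient by
    [L2_ae_eq]. *)

Section ComplexNumbers.
Variable R : realType.
Implicit Types a b : R[i].

Lemma Re_complexM a b :
  complex.Re (a * b) = complex.Re a * complex.Re b - complex.Im a * complex.Im b.
Proof. by case: a b => [? ?] []. Qed.

Lemma Im_complexM a b :
  complex.Im (a * b) = complex.Re a * complex.Im b + complex.Im a * complex.Re b.
Proof. by case: a b => [? ?] []. Qed.

Lemma Re_realM (x : R) a : complex.Re (x%:C * a) = x * complex.Re a.
Proof. by rewrite Re_complexM /= mul0r subr0. Qed.

Lemma Im_realM (x : R) a : complex.Im (x%:C * a) = x * complex.Im a.
Proof. by rewrite Im_complexM /= mul0r addr0. Qed.

Lemma Re_conjc a : complex.Re (conjc a) = complex.Re a.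
Proof. by case: a. Qed.

Lemma Im_conjc a : complex.Im (conjc a) = - complex.Im a.
Proof. by case: a. Qed.

Lemma conjcD a b : conjc (a + b) = conjc a + conjc b.
Proof. exact: rmorphD. Qed.

Lemma conjcB a b : conjc (a - b) = conjc a - conjc b.
Proof. exact: rmorphB. Qed.

Lemma conjcM a b : conjc (a * b) = conjc a * conjc b.
Proof. exact: rmorphM. Qed.

Lemma normc_sqrE a : normc a ^+ 2 = complex.Re a ^+ 2 + complex.Im a ^+ 2.
Proof. by case: a => x y /=; rewrite sqr_sqrtr// addr_ge0 ?sqr_ge0. Qed.

Lemma normc_conjc a : normc (conjc a) = normc a.
Proof. by case: a => x y /=; rewrite sqrrN. Qed.

Lemma mul_conjc a : a * conjc a = (normc a ^+ 2)%:C.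
Proof.
by rewrite normc_sqrE; case: a => x y; apply/eqP; rewrite eq_complex /=;
  apply/andP; split; apply/eqP; ring.
Qed.

Lemma normc_real (x : R) : normc (x%:C : R[i]) = `|x|.
Proof. by rewrite /= expr0n /= addr0 sqrtr_sqr. Qed.

Lemma normr_Re_le a : `|complex.Re a| <= normc a.
Proof.
by rewrite -(@ler_pXn2r _ 2) ?nnegrE ?normc_ge0// normc_sqrE real_normK ?num_real//
  lerDl sqr_ge0.
Qed.

Lemma normr_Im_le a : `|complex.Im a| <= normc a.
Proof.
by rewrite -(@ler_pXn2r _ 2) ?nnegrE ?normc_ge0// normc_sqrE real_normK ?num_real//
  lerDr sqr_ge0.
Qed.

Lemma normc_le_ReDIm a : normc a <= `|complex.Re a| + `|complex.Im a|.
Proof.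
rewrite -(@ler_pXn2r _ 2) ?nnegrE ?normc_ge0// ?addr_ge0// normc_sqrE sqrrD.
rewrite !real_normK ?num_real//.
have : 0 <= `|complex.Re a| * `|complex.Im a| by exact: mulr_ge0.
lra.
Qed.

End ComplexNumbers.

(** * Complex-valued integrals on the circle *)

Section CircleIntegral.
Variable R : realType.
Implicit Types (f g : circle R -> R[i]) (c : R[i]).
Local Notation mu := (@mcircle R).

(** Measurability by components, as in [Lp]; likewise [cintegrable] below follows [cintegral], which
    integrates the two parts separately. *)
Definition cmeasurable f := measurable_fun [set: circle R] (fun z => complex.Re (f z)) /\
  measurable_fun [set: circle R] (fun z => complex.Im (f z)).

Lemma cmeasurable_normc f :
  cmeasurable f -> measurable_fun [set: circle R] (fun z => normc (f z)).
Proof. by case; exact: measurable_normc. Qed.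

Lemma cmeasurable_cst c : cmeasurable (cst c).
Proof. by split; exact: measurable_cst. Qed.

Lemma cmeasurableD f g :
  cmeasurable f -> cmeasurable g -> cmeasurable (fun z => f z + g z).
Proof.
move=> [f1 f2] [g1 g2]; split.
- under eq_fun do rewrite raddfD; exact: measurable_funD.
- under eq_fun do rewrite raddfD; exact: measurable_funD.
Qed.

Lemma cmeasurableM f g :
  cmeasurable f -> cmeasurable g -> cmeasurable (fun z => f z * g z).
Proof.
move=> [f1 f2] [g1 g2]; split.
- under eq_fun do rewrite Re_complexM; by apply: measurable_funB; exact: measurable_funM.
- under eq_fun do rewrite Im_complexM; by apply: measurable_funD; exact: measurable_funM.
Qed.

Lemma cmeasurableB f g :
  cmeasurable f -> cmeasurable g -> cmeasurable (fun z => f z - g z).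
Proof.
move=> mf mg; have := cmeasurableD mf (cmeasurableM (cmeasurable_cst (-1)) mg).
by rewrite [X in cmeasurable X](_ : _ = fun z => f z - g z)//; apply/funext => z /=;
  rewrite mulN1r.
Qed.

Lemma cmeasurable_conjc f : cmeasurable f -> cmeasurable (fun z => conjc (f z)).
Proof.
move=> [f1 f2]; split.
- by under eq_fun do rewrite Re_conjc.
- by under eq_fun do rewrite Im_conjc; exact: measurable_funN.
Qed.

Lemma cmeasurable_real (u : circle R -> R) : measurable_fun [set: circle R] u ->
  cmeasurable (fun z => (u z)%:C).
Proof. by move=> mu; split => //; exact: measurable_cst. Qed.

Definition cintegrable f := mu.-integrable [set: circle R] (EFin \o (fun z => complex.Re (f z))) /\
  mu.-integrable [set: circle R] (EFin \o (fun z => complex.Im (f z))).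

Lemma cintegrable_measurable f : cintegrable f -> cmeasurable f.
Proof.
by case=> /measurable_int/measurable_EFinP f1 /measurable_int/measurable_EFinP f2.
Qed.

Lemma integrable_normc f : cintegrable f ->
  mu.-integrable [set: circle R] (EFin \o (fun z => normc (f z))).
Proof.
move=> fi; have [f1 f2] := fi.
have := integrableD measurableT (integrable_abse f1) (integrable_abse f2).
apply: le_integrable => //.
  by apply/measurable_EFinP; apply: cmeasurable_normc; exact: cintegrable_measurable.
move=> z _ /=; rewrite lee_fin ger0_norm ?normc_ge0// ger0_norm ?addr_ge0//.
exact: normc_le_ReDIm.
Qed.

Lemma le_cintegrable f (u : circle R -> R) : cmeasurable f ->
  (forall z, normc (f z) <= u z) -> mu.-integrable [set: circle R] (EFin \o u) ->
  cintegrable f.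
Proof.
move=> [f1 f2] fu ui; split.
- apply: le_integrable ui => //; first exact/measurable_EFinP.
  move=> z _ /=; rewrite lee_fin (le_trans _ (ler_norm _))// (le_trans _ (fu z))//.
  exact: normr_Re_le.
- apply: le_integrable ui => //; first exact/measurable_EFinP.
  move=> z _ /=; rewrite lee_fin (le_trans _ (ler_norm _))// (le_trans _ (fu z))//.
  exact: normr_Im_le.
Qed.

Lemma cintegrableD f g :
  cintegrable f -> cintegrable g -> cintegrable (fun z => f z + g z).
Proof.
move=> [f1 f2] [g1 g2]; split.
- rewrite (_ : _ \o _ = (EFin \o (fun z => complex.Re (f z))) \+
    (EFin \o (fun z => complex.Re (g z))))%E; last first.
    by apply/funext => z /=; rewrite raddfD EFinD.
  exact: integrableD.
- rewrite (_ : _ \o _ = (EFin \o (fun z => complex.Im (f z))) \+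
    (EFin \o (fun z => complex.Im (g z))))%E; last first.
    by apply/funext => z /=; rewrite raddfD EFinD.
  exact: integrableD.
Qed.

Lemma cintegralD f g : cintegrable f -> cintegrable g ->
  cintegral (fun z => f z + g z) = cintegral f + cintegral g.
Proof.
move=> [f1 f2] [g1 g2]; apply/eqP; rewrite eq_complex /=; apply/andP; split; apply/eqP.
- under eq_Rintegral do rewrite raddfD; exact: RintegralD.
- under eq_Rintegral do rewrite raddfD; exact: RintegralD.
Qed.

Lemma cintegrable_mulbounded f g (M : R) : cmeasurable f ->
  (forall z, normc (f z) <= M) -> cintegrable g -> cintegrable (fun z => f z * g z).
Proof.
move=> mf fM gi.
apply: (@le_cintegrable _ (fun z => M * normc (g z))).
- by apply: cmeasurableM => //; exact: cintegrable_measurable.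
- by move=> z; rewrite normcM ler_wpM2r ?normc_ge0.
- exact: (integrableZl measurableT M (integrable_normc gi)).
Qed.

Lemma cintegrableZ c f : cintegrable f -> cintegrable (fun z => c * f z).
Proof.
by apply: (@cintegrable_mulbounded (cst c) f (normc c)) => //; exact: cmeasurable_cst.
Qed.

Lemma cintegralZ c f : cintegrable f -> cintegral (fun z => c * f z) = c * cintegral f.
Proof.
move=> [f1 f2]; apply/eqP; rewrite eq_complex; apply/andP; split; apply/eqP => /=.
- rewrite Re_complexM /=; under eq_Rintegral do rewrite Re_complexM.
  rewrite RintegralB//=;
    [|exact: (integrableZl measurableT _ f1)|exact: (integrableZl measurableT _ f2)].
  by rewrite !RintegralZl.
- rewrite Im_complexM /=; under eq_Rintegral do rewrite Im_complexM.
  rewrite RintegralD//=;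
    [|exact: (integrableZl measurableT _ f2)|exact: (integrableZl measurableT _ f1)].
  by rewrite !RintegralZl.
Qed.

Lemma cintegral_conjc f : cintegrable f ->
  cintegral (fun z => conjc (f z)) = conjc (cintegral f).
Proof.
move=> [f1 f2]; apply/eqP; rewrite eq_complex; apply/andP; split; apply/eqP => /=.
- by under eq_Rintegral do rewrite Re_conjc.
- under eq_Rintegral do rewrite Im_conjc -mulN1r.
  by rewrite RintegralZl// mulN1r.
Qed.

Lemma ae_cintegral f g : cmeasurable f -> cmeasurable g ->
  {ae mu, forall z, f z = g z} -> cintegral f = cintegral g.
Proof.
move=> [f1 f2] [g1 g2] fg; rewrite /cintegral /Rintegral.
congr (fine _ +i* fine _); apply: ae_eq_integral => //;
  try (exact/measurable_EFinP); by apply: filterS fg => z -> _.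
Qed.

Lemma integrable_bounded (u : circle R -> R) (M : R) : measurable_fun [set: circle R] u ->
  (forall z, `|u z| <= M) -> mu.-integrable [set: circle R] (EFin \o u).
Proof.
move=> mf uM; apply: measurable_bounded_integrable => //.
  by rewrite [X in (X < _)%E]mcircle_setT ltry.
exists M; split; first exact: num_real.
by move=> x Mx z _ /=; rewrite (le_trans (uM z))// ltW.
Qed.

Lemma integrable_cst (M : R) : mu.-integrable [set: circle R] (EFin \o cst M).
Proof. by apply: (@integrable_bounded _ `|M|). Qed.

Lemma cintegrable_bounded f (M : R) : cmeasurable f ->
  (forall z, normc (f z) <= M) -> cintegrable f.
Proof. by move=> mf fM; apply: (le_cintegrable mf fM); exact: integrable_cst. Qed.

End CircleIntegral.

(** * Inner product and multiplication operators *)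

Section SquareIntegrable.
Variable R : realType.
Implicit Types (f g : circle R -> R[i]) (c : R[i]) (x y : L2 R).
Local Notation mu := (@mcircle R).

Lemma Lnorm2_sqr (u : circle R -> R) : (forall z, 0 <= u z) ->
  ('N[mu]_2[EFin \o u] `^ 2 = \int[mu]_z (u z ^+ 2)%:E)%E.
Proof.
move=> u0; rewrite (poweR_Lnorm _ (EFin \o u)) ?pnatr_eq0//.
by apply: eq_integral => z _ /=; rewrite ger0_norm// powR_mulrn.
Qed.

Lemma Lp2_integrable f :
  Lp 2%:E f -> mu.-integrable [set: circle R] (EFin \o (fun z => normc (f z) ^+ 2)).
Proof.
case=> m1 m2 fin; apply/integrableP; split.
  by apply/measurable_EFinP; apply: measurable_funX; exact: measurable_normc.
under eq_integral => z _ do rewrite /= ger0_norm ?exprn_ge0 ?normc_ge0//.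
rewrite -Lnorm2_sqr; last by move=> z; exact: normc_ge0.
exact: poweR_lty.
Qed.

Lemma integrable_Lp2 f : cmeasurable f ->
  mu.-integrable [set: circle R] (EFin \o (fun z => normc (f z) ^+ 2)) -> Lp 2%:E f.
Proof.
move=> [m1 m2] /integrable_lty fi; split => //; rewrite /finite_norm.
have := fi measurableT; rewrite -Lnorm2_sqr; last by move=> z; exact: normc_ge0.
rewrite ltNge => /negP h; rewrite ltNge; apply/negP; rewrite leye_eq => /eqP N2.
by apply: h; rewrite N2 poweRyr ?pnatr_eq0.
Qed.

Lemma L2_cmeasurable x : cmeasurable x.
Proof. by have [] := L2_valP x. Qed.

Lemma L2_sqr_integrable x :
  mu.-integrable [set: circle R] (EFin \o (fun z => normc (x z) ^+ 2)).
Proof. exact/Lp2_integrable/L2_valP. Qed.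

Lemma L2_norm_sqr x : ((`|x| ^+ 2)%:E = \int[mu]_z (normc (x z) ^+ 2)%:E)%E.
Proof.
rewrite -Lnorm2_sqr; last by move=> z; exact: normc_ge0.
by rewrite -L2_normE poweR_EFin powR_mulrn// (normr_ge0 x).
Qed.

Lemma toL2_ae f : Lp 2%:E f -> {ae mu, forall z, toL2 f z = f z}.
Proof.
move=> Lf; have := L2_val_pi (insubd (0 : L2fun R) f).
by apply: filterS => z; rewrite -/(toL2 f) => ->; rewrite insubdK//; exact/asboolP.
Qed.

Lemma L2_ae_eq x y : {ae mu, forall z, x z = y z} -> x = y.
Proof. by move=> xy; rewrite -[x]reprK -[y]reprK; apply/eqP/L2_eqP. Qed.

Lemma ae_L2D x y : {ae mu, forall z, (x + y : L2 R) z = x z + y z}.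
Proof.
have := L2_val_pi (repr x + repr y); rewrite pi_L2D !reprK.
by apply: filterS => z ->.
Qed.

Lemma ae_L2Z c x : {ae mu, forall z, (c *: x : L2 R) z = c * x z}.
Proof.
have := L2_val_pi (c *: repr x).
by apply: filterS => z; rewrite -/(L2_scale c x) => ->.
Qed.

Lemma L2Z_norm c x : `|c *: x| = normc c * `|x|.
Proof. exact: L2_norm_scale. Qed.

Lemma ae_L2N x : {ae mu, forall z, (- x : L2 R) z = - x z}.
Proof. by have := ae_L2Z (-1) x; rewrite scaleN1r; apply: filterS => z ->; rewrite mulN1r. Qed.

Lemma ae_L2B x y : {ae mu, forall z, (x - y : L2 R) z = x z - y z}.
Proof. by apply: filterS2 (ae_L2D x (- y)) (ae_L2N y) => z -> ->. Qed.

Lemma ae_L20 : {ae mu, forall z, (0 : L2 R) z = 0}.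
Proof. by have := ae_L2Z 0 0; rewrite scaler0; apply: filterS => z ->; rewrite mul0r. Qed.

(** The total mass is finite, so L^2 lies in L^1 through a <= 1 + a^2. *)
Lemma L2_cintegrable x : cintegrable x.
Proof.
apply: (@le_cintegrable _ _ (fun z => 1 + normc (x z) ^+ 2)).
- exact: L2_cmeasurable.
- by move=> z; have := normc_ge0 (x z); move: (normc (x z)) => a; nra.
- exact: (integrableD measurableT (integrable_cst 1) (L2_sqr_integrable x)).
Qed.

Lemma cintegrable_inner x y : cintegrable (fun z => x z * conjc (y z)).
Proof.
apply: (@le_cintegrable _ _ (fun z => normc (x z) ^+ 2 + normc (y z) ^+ 2)).
- by apply: cmeasurableM; [exact: L2_cmeasurable|exact/cmeasurable_conjc/L2_cmeasurable].
- move=> z; rewrite normcM normc_conjc.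
  have := normc_ge0 (x z); have := normc_ge0 (y z).
  move: (normc (x z)) (normc (y z)) => a b; nra.
- exact: (integrableD measurableT (L2_sqr_integrable x) (L2_sqr_integrable y)).
Qed.

Lemma innerDl x y w : inner (x + y) w = inner x w + inner y w.
Proof.
rewrite /inner -cintegralD; [|exact: cintegrable_inner..].
apply: ae_cintegral.
- exact/cintegrable_measurable/cintegrable_inner.
- by apply: cintegrable_measurable; apply: cintegrableD; exact: cintegrable_inner.
- by apply: filterS (ae_L2D x y) => z ->; rewrite mulrDl.
Qed.

Lemma innerZl c x w : inner (c *: x) w = c * inner x w.
Proof.
rewrite /inner -cintegralZ; last exact: cintegrable_inner.
apply: ae_cintegral.
- exact/cintegrable_measurable/cintegrable_inner.
- by apply: cintegrable_measurable; apply: cintegrableZ; exact: cintegrable_inner.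
- by apply: filterS (ae_L2Z c x) => z ->; rewrite mulrA.
Qed.

Lemma innerC x y : inner y x = conjc (inner x y).
Proof.
rewrite /inner -cintegral_conjc; last exact: cintegrable_inner.
by congr cintegral; apply/funext => z; rewrite conjcM conjcK mulrC.
Qed.

Lemma innerNl x w : inner (- x) w = - inner x w.
Proof. by rewrite -scaleN1r innerZl mulN1r. Qed.

Lemma innerBl x y w : inner (x - y) w = inner x w - inner y w.
Proof. by rewrite innerDl innerNl. Qed.

Lemma inner0l w : inner (0 : L2 R) w = 0.
Proof. by rewrite -(scale0r 0) innerZl mul0r. Qed.

Lemma innerDr x y w : inner w (x + y) = inner w x + inner w y.
Proof. by rewrite innerC innerDl (innerC w x) (innerC w y) conjcD !conjcK. Qed.

Lemma innerZr c x w : inner w (c *: x) = conjc c * inner w x.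
Proof. by rewrite innerC innerZl (innerC w x) conjcM conjcK. Qed.

Lemma innerBr x y w : inner w (x - y) = inner w x - inner w y.
Proof. by rewrite innerC innerBl (innerC w x) (innerC w y) conjcB !conjcK. Qed.

Lemma inner0r w : inner w (0 : L2 R) = 0.
Proof. by rewrite innerC inner0l conjc0. Qed.

Lemma inner_sqr x : inner x x = (`|x| ^+ 2)%:C.
Proof.
rewrite /inner; under [X in cintegral X]eq_fun do rewrite mul_conjc.
rewrite /cintegral /= Rintegral_cst//= mul0r; congr (_ +i* _).
by apply: EFin_inj; rewrite L2_norm_sqr /Rintegral fineK// integrable_fin_num//;
  exact: L2_sqr_integrable.
Qed.

Lemma pythagoras x y : inner x y = 0 -> `|x + y| ^+ 2 = `|x| ^+ 2 + `|y| ^+ 2.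
Proof.
move=> xy; apply: (@complexI R); rewrite -inner_sqr innerDl !innerDr (innerC x y) xy.
by rewrite conjc0 add0r addr0 !inner_sqr raddfD.
Qed.

(** Cauchy-Schwarz: [t *: y] is the orthogonal projection of [x] onto the line of [y], and
    Pythagoras bounds its norm by that of [x]. *)
Lemma inner_le x y : normc (inner x y) <= `|x| * `|y|.
Proof.
have [->|y0] := eqVneq y 0; first by rewrite inner0r normc0 normr0 mulr0.
have ny : 0 < `|y| by rewrite normr_gt0.
pose t := ((`|y| ^+ 2)^-1)%:C * inner x y.
have y2 : `|y| ^+ 2 != 0 by rewrite sqrf_eq0 gt_eqF.
have ort : inner (t *: y) (x - t *: y) = 0.
  rewrite innerZl innerBr innerZr inner_sqr (innerC x y) /t conjcM conjc_real mulrAC.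
  have -> : (`|y| ^- 2)%:C * conjc (inner x y) * (`|y| ^+ 2)%:C = conjc (inner x y).
    by rewrite mulrAC -(rmorphM (real_complex R)) mulVf// mul1r.
  by rewrite subrr mulr0 mul0r.
have := pythagoras ort; rewrite addrC subrK => e.
have : `|t *: y| <= `|x|.
  by rewrite -(@ler_pXn2r _ 2) ?nnegrE// e lerDl sqr_ge0.
rewrite L2Z_norm /t normcM normc_real ger0_norm ?invr_ge0 ?sqr_ge0// => h.
rewrite -ler_pdivrMr//; apply: le_trans h.
by rewrite mulrAC expr2 invfM -[X in _ <= X * _]mulrA mulVf ?gt_eqF// mulr1 mulrC.
Qed.

Lemma Lp2_mul f x (M : R) : cmeasurable f ->
  {ae mu, forall z, normc (f z) <= M} -> Lp 2%:E (fun z => f z * x z).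
Proof.
move=> mf fM; apply: integrable_Lp2; first by apply: cmeasurableM => //; exact: L2_cmeasurable.
have mfx : measurable_fun [set: circle R] (fun z => normc (f z * x z)).
  by apply: cmeasurable_normc; apply: cmeasurableM => //; exact: L2_cmeasurable.
apply/integrableP; split; first by apply/measurable_EFinP; exact: measurable_funX.
have /integrable_lty := integrableZl measurableT (M ^+ 2) (L2_sqr_integrable x).
move=> /(_ measurableT); apply: le_lt_trans.
apply: ae_ge0_le_integral => //.
- apply/measurable_EFinP; apply: measurableT_comp => //; exact: measurable_funX.
- by move=> z _; rewrite -EFinM lee_fin mulr_ge0 ?sqr_ge0.
- apply/measurable_EFinP; apply: measurable_funM => //; apply: measurable_funX.
  apply: cmeasurable_normc; exact: L2_cmeasurable.
- apply: filterS fM => z fz _; rewrite /= lee_fin ger0_norm ?sqr_ge0//.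
  by rewrite normcM exprMn ler_wpM2r ?sqr_ge0// lerXn2r ?nnegrE ?normc_ge0
    ?(le_trans (normc_ge0 _) fz).
Qed.

Lemma le_L2_norm x y : {ae mu, forall z, normc (x z) <= normc (y z)} -> `|x| <= `|y|.
Proof.
move=> xy; rewrite -(@ler_pXn2r _ 2) ?nnegrE// -lee_fin !L2_norm_sqr.
apply: ae_ge0_le_integral => //.
- by move=> z _; rewrite lee_fin sqr_ge0.
- apply/measurable_EFinP; apply: measurable_funX; apply: cmeasurable_normc.
  exact: L2_cmeasurable.
- by move=> z _; rewrite lee_fin sqr_ge0.
- apply/measurable_EFinP; apply: measurable_funX; apply: cmeasurable_normc.
  exact: L2_cmeasurable.
- by apply: filterS xy => z xyz _; rewrite lee_fin lerXn2r ?nnegrE ?normc_ge0.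
Qed.

End SquareIntegrable.

(** * Multiplication by essentially bounded functions *)

Section Multiplication.
Variable R : realType.
Implicit Types (f g : circle R -> R[i]) (c : R[i]) (x y : L2 R).
Local Notation mu := (@mcircle R).

(** [M] is any essential upper bound, not the essential supremum; keeping it explicit lets bounds be
    passed on to sums and conjugates. *)
Definition ess_bounded f (M : R) := cmeasurable f /\ {ae mu, forall z, normc (f z) <= M}.

Lemma Lpoo_bounded f : Lp +oo%E f -> exists M, ess_bounded f M.
Proof.
move=> [m1 m2]; rewrite /finite_norm unlock /Lnorm /=.
(* The norm of exponent +oo is an essential supremum only on a space of positive measure, which the
   total mass 1 guarantees. *)
rewrite mcircle_setT lte01 => h.
have /ess_sup_inf.ess_supr_bounded [M hM] :
    (ess_sup_inf.ess_sup mu (EFin \o (fun z => `|normc (f z)|%R)) < +oo)%E.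
  by [].
exists M; split => //; apply: filterS hM => z.
by rewrite ger0_norm ?normc_ge0.
Qed.

Lemma mulL2_ae f M x : ess_bounded f M -> {ae mu, forall z, mulL2 f x z = f z * x z}.
Proof. by move=> [mf fM]; apply: toL2_ae; exact: Lp2_mul fM. Qed.

Lemma mulL2D f M x y : ess_bounded f M -> mulL2 f (x + y) = mulL2 f x + mulL2 f y.
Proof.
move=> fM; apply: L2_ae_eq.
apply: filterS3 (mulL2_ae (x + y) fM) (ae_L2D x y)
  (filterI (ae_L2D (mulL2 f x) (mulL2 f y)) (filterI (mulL2_ae x fM) (mulL2_ae y fM))) => z.
by move=> -> -> [-> [-> ->]]; rewrite mulrDr.
Qed.

Lemma mulL2Z f M c x : ess_bounded f M -> mulL2 f (c *: x) = c *: mulL2 f x.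
Proof.
move=> fM; apply: L2_ae_eq.
apply: filterS3 (mulL2_ae (c *: x) fM) (ae_L2Z c x)
  (filterI (ae_L2Z c (mulL2 f x)) (mulL2_ae x fM)) => z.
by move=> -> -> [-> ->]; rewrite mulrCA.
Qed.

Lemma mulL2_norm f M x : ess_bounded f M -> `|mulL2 f x| <= M * `|x|.
Proof.
move=> fM; have [mf fM'] := fM.
(* A negative bound would make the whole circle negligible. *)
have M0 : 0 <= M.
  rewrite leNgt; apply/negP => M0.
  suff : mu [set: circle R] = 0%E by rewrite mcircle_setT => /eqP; rewrite eqe oner_eq0.
  apply/negligibleP => //; apply: negligibleS fM' => z _ /=.
  by apply/negP; rewrite -ltNge (lt_le_trans M0)// normc_ge0.
rewrite -[M]ger0_norm// -normc_real -L2Z_norm; apply: le_L2_norm.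
apply: filterS3 (mulL2_ae x fM) (ae_L2Z M%:C x) fM' => z -> -> fz.
by rewrite !normcM ler_wpM2r ?normc_ge0// normc_real (le_trans fz)// ler_norm.
Qed.

Lemma mulL20r f M : ess_bounded f M -> mulL2 f (0 : L2 R) = 0.
Proof. by move=> fM; rewrite -[X in mulL2 f X](scale0r (0 : L2 R)) (mulL2Z _ _ fM) scale0r. Qed.

Lemma mulL20l x : mulL2 (fun=> 0) x = 0.
Proof.
have f0 : ess_bounded (fun=> 0) 0.
  by split; [exact: cmeasurable_cst|apply: nearW => z; rewrite normc0].
apply: L2_ae_eq; apply: filterS2 (mulL2_ae x f0) (ae_L20 R) => z -> ->.
by rewrite mul0r.
Qed.

Lemma inner_mulL2 f M x y : ess_bounded f M ->
  inner (mulL2 f x) y = inner x (mulL2 (fun z => conjc (f z)) y).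
Proof.
move=> fM; have [mf fM'] := fM.
have cfM : ess_bounded (fun z => conjc (f z)) M.
  by split; [exact: cmeasurable_conjc|apply: filterS fM' => z; rewrite normc_conjc].
apply: ae_cintegral; try exact/cintegrable_measurable/cintegrable_inner.
apply: filterS2 (mulL2_ae x fM) (mulL2_ae y cfM) => z -> ->.
by rewrite conjcM conjcK mulrAC mulrC mulrA.
Qed.

End Multiplication.

(** * Completeness of L^2 *)

Section Completeness.
Variable R : realType.
Implicit Types (x y : L2 R).
Local Notation mu := (@mcircle R).

Lemma Rintegral_sqr x : \int[mu]_z (normc (x z) ^+ 2) = `|x| ^+ 2.
Proof. by apply: EFin_inj; rewrite L2_norm_sqr /Rintegral fineK// integrable_fin_num//;
  exact: L2_sqr_integrable. Qed.

(** Integrate a <= a^2 / (2 d) + d / 2, which is (a - d)^2 >= 0; each term on the right contributes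
    at most d / 2. *)
Lemma integral_normc_le x (d : R) : 0 < d -> `|x| <= d ->
  (\int[mu]_z (normc (x z))%:E <= d%:E)%E.
Proof.
move=> d0 xd.
have nxi := integrable_normc (L2_cintegrable x).
have sqi : mu.-integrable [set: circle R] (EFin \o (fun z => (2 * d)^-1 * normc (x z) ^+ 2)).
  exact: (integrableZl measurableT (2 * d)^-1 (L2_sqr_integrable x)).
suff h : \int[mu]_z (normc (x z)) <= d.
  by rewrite -(fineK (integrable_fin_num measurableT nxi)) lee_fin.
apply: (@le_trans _ _ (\int[mu]_z ((2 * d)^-1 * normc (x z) ^+ 2 + d / 2))).
  apply: le_Rintegral => //.
    exact: (integrableD measurableT sqi (integrable_cst (d / 2))).
  move=> z _; rewrite -subr_ge0.
  rewrite (_ : _ - _ = (normc (x z) - d) ^+ 2 / (2 * d)).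
    by rewrite divr_ge0 ?sqr_ge0 ?mulr_ge0 ?ltW.
  by field; rewrite gt_eqF.
rewrite RintegralD//; last exact: (integrable_cst (d / 2)).
rewrite (RintegralZl _ measurableT (L2_sqr_integrable x)).
rewrite Rintegral_sqr Rintegral_cst// [X in fine X]mcircle_setT mulr1.
have : `|x| ^+ 2 <= d ^+ 2 by rewrite lerXn2r ?nnegrE// ltW.
move=> xd2; rewrite -lerBrDr (_ : d - d / 2 = (2 * d)^-1 * d ^+ 2).
  by rewrite ler_wpM2l// invr_ge0 mulr_ge0// ltW.
by field; rewrite gt_eqF.
Qed.

Lemma limn_einf_cvg (u : nat -> \bar R) l : u @ \oo --> l -> limn_einf u = l.
Proof. by move=> ul; rewrite limn_einf_lim; apply/cvg_lim => //; exact: cvg_einfs. Qed.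

Lemma limn_einf_le (u : nat -> \bar R) l : (forall n, (u n <= l)%E) -> (limn_einf u <= l)%E.
Proof.
move=> ul; rewrite limn_einf_lim; apply: lime_le; first exact: is_cvg_einfs.
apply: nearW => n; apply: le_trans (ul n); apply: ereal_inf_lbound; exists n => //=.
Qed.

Lemma cvgn_summable_diff (a : nat -> R) (d : nat -> R) :
  (forall n, `|a n.+1 - a n| <= d n) -> (\sum_(k <oo) (d k)%:E < +oo)%E -> cvgn a.
Proof.
move=> ad dfin.
have d0 n : 0 <= d n by exact: le_trans (ad n).
have cd : cvgn (series d).
  have cvgE : cvgn (fun n => \sum_(0 <= k < n) (d k)%:E)%E.
    by apply: is_cvg_nneseries => n _ _; rewrite lee_fin.
  apply: nondecreasing_is_cvgn.
    by move=> m n mn; rewrite /series /= [leRHS](@big_cat_nat _ _ _ m)//= lerDl sumr_ge0.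
  exists (fine (\sum_(k <oo) (d k)%:E)%E) => _ [n _ <-].
  rewrite -lee_fin fineK.
    rewrite /series /= -sumEFin; apply: nneseries_lim_ge => k _ _.
    by rewrite lee_fin.
  rewrite ge0_fin_numE//; apply: nneseries_ge0 => k _ _.
  by rewrite lee_fin.
have : cvgn (series (telescope a)).
  apply: normed_cvg; apply: series_le_cvg cd => n //=; exact: ad.
rewrite telescopeK => ca.
have -> : a = (fun n => (a n - a 0%N) + a 0%N) by apply/funext => n; rewrite subrK.
by apply: is_cvgD => //; exact: is_cvg_cst.
Qed.

(* Riesz-Fischer: the series of the increments converges absolutely almost
   everywhere, and Fatou's lemma identifies its sum with the limit in L^2. *)
Lemma L2_cvg_fast (v : nat -> L2 R) : (forall j, `|v j.+1 - v j| <= 2^-1 ^+ j) ->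
  exists l : L2 R, forall j, `|v j - l| <= 2 * 2^-1 ^+ j.
Proof.
move=> vd.
have vdiff i j : `|v (i + j)%N - v j| <= 2 * 2^-1 ^+ j.
  (* The factor 1 - 2^-i of the finite geometric sum is what lets the induction close. *)
  suff h : `|v (i + j)%N - v j| <= 2 * 2^-1 ^+ j * (1 - 2^-1 ^+ i).
    by apply: (le_trans h); rewrite ler_piMr ?mulr_ge0 ?exprn_ge0//.
  elim: i => [|i IH]; first by rewrite add0n subrr normr0 expr0 subrr mulr0.
  rewrite addSn (_ : v _ - _ = (v (i + j).+1 - v (i + j)%N) + (v (i + j)%N - v j)).
    apply: (le_trans (ler_normD _ _)); apply: (le_trans (lerD (vd _) IH)).
    rewrite exprD [2^-1 ^+ i.+1]exprS le_eqVlt; apply/orP; left; apply/eqP.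
    by field.
  by rewrite addrA subrK.
pose d j z := normc (v j.+1 z - v j z).
have md j : measurable_fun [set: circle R] (d j).
  by apply: cmeasurable_normc; apply: cmeasurableB; exact: L2_cmeasurable.
have d0 j z : 0 <= d j z by exact: normc_ge0.
pose F z := (\sum_(j <oo) (d j z)%:E)%E.
have mF : measurable_fun [set: circle R] F.
  apply: (@emeasurable_fun_cvg _ _ _ _ (fun n z => \sum_(0 <= j < n) (d j z)%:E)%E).
    by move=> n; apply: emeasurable_sum => j; exact/measurable_EFinP.
  move=> z _; apply: is_cvg_nneseries => n _ _.
  by rewrite lee_fin.
have F0 z : (0 <= F z)%E by apply: nneseries_ge0 => n _ _; rewrite lee_fin.
have Ffin : (\int[mu]_z F z < +oo)%E.
  rewrite integral_nneseries//.
  - apply: (@le_lt_trans _ _ (\sum_(j <oo) (2 / (2 ^ (j + 1))%:R)%:E)%E); last first.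
      by rewrite (cvg_lim _ (@cvg_geometric_eseries_half R 2 0))// ltry.
    apply: lee_nneseries => [j _ _|j _].
      by apply: integral_ge0 => z _; rewrite lee_fin.
    have -> : (2 / (2 ^ (j + 1))%:R)%R = 2^-1 ^+ j :> R.
      by rewrite addn1 natrX exprS exprVn invfM mulrA mulfV// mul1r.
    apply: (@le_trans _ _ (\int[mu]_z (normc ((v j.+1 - v j : L2 R) z))%:E)%E).
      apply: ae_ge0_le_integral => //.
      + by move=> z _; rewrite lee_fin.
      + exact/measurable_EFinP.
      + by move=> z _; rewrite lee_fin normc_ge0.
      + by apply/measurable_EFinP; apply: cmeasurable_normc; exact: L2_cmeasurable.
      + by apply: filterS (ae_L2B (v j.+1) (v j)) => z -> _.
    by apply: integral_normc_le => //; rewrite exprn_gt0.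
  - by move=> j; exact/measurable_EFinP.
  - by move=> j z _; rewrite lee_fin.
have Fi : mu.-integrable [set: circle R] F.
  apply/integrableP; split => //.
  by under eq_integral => z _ do rewrite gee0_abs//.
pose E := [set z | (F z < +oo)%E].
have mE : measurable E.
  by rewrite -[E]setTI; exact: emeasurable_fun_infty_o.
have aeE : {ae mu, forall z, E z}.
  apply: filterS (integrable_ae measurableT Fi) => z /(_ I).
  by rewrite ge0_fin_numE.
(* Cut off outside [E], the representatives converge at every point, so their limit is measurable;
   only a null set is affected. *)
pose w j z := v j z * (\1_E z)%:C.
have mw j : cmeasurable (w j).
  by apply: cmeasurableM; [exact: L2_cmeasurable|apply: cmeasurable_real; exact: measurable_indic].
have aew : {ae mu, forall z, forall j, w j z = v j z}.
  by apply: filterS aeE => z Ez j; rewrite /w indicE mem_set// mulr1.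
have wE z : ~ E z -> forall j, w j z = 0.
  by move=> Ez j; rewrite /w indicE memNset// mulr0.
have cRe z : cvgn (fun j => complex.Re (w j z)).
  have [Ez|/wE w0] := pselect (E z); last first.
    under eq_fun do rewrite w0; exact: is_cvg_cst.
  apply: (@cvgn_summable_diff _ (d ^~ z)) => // n.
  by rewrite -raddfB /= /w indicE mem_set// !mulr1; exact: normr_Re_le.
have cIm z : cvgn (fun j => complex.Im (w j z)).
  have [Ez|/wE w0] := pselect (E z); last first.
    under eq_fun do rewrite w0; exact: is_cvg_cst.
  apply: (@cvgn_summable_diff _ (d ^~ z)) => // n.
  by rewrite -raddfB /= /w indicE mem_set// !mulr1; exact: normr_Im_le.
pose l z := limn (fun j => complex.Re (w j z)) +i* limn (fun j => complex.Im (w j z)).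
have ml : cmeasurable l.
  split.
    apply: (@measurable_fun_cvg _ _ _ _ (fun j z => complex.Re (w j z))) => [j|z _].
      by have [] := mw j.
    exact: cRe.
  apply: (@measurable_fun_cvg _ _ _ _ (fun j z => complex.Im (w j z))) => [j|z _].
    by have [] := mw j.
  exact: cIm.
have ldist j : (\int[mu]_z (normc (l z - w j z) ^+ 2)%:E <= ((2 * 2^-1 ^+ j) ^+ 2)%:E)%E.
  pose f i z := (normc (w (i + j)%N z - w j z) ^+ 2)%:E.
  have mf i : measurable_fun [set: circle R] (f i).
    apply/measurable_EFinP; apply: measurable_funX; apply: cmeasurable_normc.
    exact: cmeasurableB.
  have f0 i z : [set: circle R] z -> (0 <= f i z)%E by rewrite lee_fin sqr_ge0.
  have -> : (\int[mu]_z (normc (l z - w j z) ^+ 2)%:E)%E =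
            (\int[mu]_z limn_einf (f ^~ z))%E.
    apply: eq_integral => z _; apply/esym/limn_einf_cvg.
    apply: cvg_EFin; first exact: nearW.
    rewrite [X in X @ _ --> _](_ : _ = fun i =>
        (complex.Re (w (i + j)%N z) - complex.Re (w j z)) ^+ 2 +
        (complex.Im (w (i + j)%N z) - complex.Im (w j z)) ^+ 2); last first.
      apply/funext => i; transitivity (normc (w (i + j)%N z - w j z) ^+ 2); first by [].
      by rewrite normc_sqrE !raddfB.
    rewrite normc_sqrE !raddfB /=.
    have cvgsq (a : nat -> R) (b : R) : cvgn a ->
        (a (i + j)%N - b) ^+ 2 @[i --> \oo] --> (limn a - b) ^+ 2.
      move=> ca; under eq_fun do rewrite expr2; rewrite expr2.
      have h : a (i + j)%N - b @[i --> \oo] --> limn a - b.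
        by apply: cvgB; [rewrite cvg_shiftn|exact: cvg_cst].
      exact: cvgM.
    by apply: cvgD; exact: cvgsq.
  apply: le_trans (fatou _ measurableT mf f0) _; apply: limn_einf_le => i.
  apply: (@le_trans _ _ (\int[mu]_z (normc ((v (i + j)%N - v j : L2 R) z) ^+ 2)%:E)%E).
    apply: ae_ge0_le_integral => //.
    + exact: f0.
    + by move=> z _; rewrite lee_fin sqr_ge0.
    + apply/measurable_EFinP; apply: measurable_funX; apply: cmeasurable_normc.
      exact: L2_cmeasurable.
    + by apply: filterS2 aew (ae_L2B (v (i + j)%N) (v j)) => z wz -> _; rewrite /f !wz.
  by rewrite -L2_norm_sqr lee_fin lerXn2r ?nnegrE ?mulr_ge0 ?exprn_ge0.
have mlw j : cmeasurable (fun z => l z - w j z) by exact: cmeasurableB.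
have Lplw j : Lp 2%:E (fun z => l z - w j z).
  apply: integrable_Lp2 => //; apply/integrableP; split.
    by apply/measurable_EFinP; apply: measurable_funX; exact: cmeasurable_normc.
  under eq_integral => z _ do rewrite /= ger0_norm ?sqr_ge0//.
  exact: le_lt_trans (ldist j) (ltry _).
(* Only the differences [l - w j] are known to be square-integrable, so the limit is [v 0] plus the
   class of one of them. *)
exists (v 0%N + toL2 (fun z => l z - w 0%N z)) => j.
rewrite -normrN opprB -(@ler_pXn2r _ 2) ?nnegrE ?mulr_ge0 ?exprn_ge0//.
rewrite -lee_fin; apply: le_trans (ldist j); rewrite L2_norm_sqr.
apply: ae_ge0_le_integral => //.
- by move=> z _; rewrite lee_fin sqr_ge0.
- apply/measurable_EFinP; apply: measurable_funX; apply: cmeasurable_normc.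
  exact: L2_cmeasurable.
- by move=> z _; rewrite lee_fin sqr_ge0.
- by apply/measurable_EFinP; apply: measurable_funX; exact: cmeasurable_normc.
- apply: filterS3 aew (ae_L2B (v 0%N + toL2 (fun z => l z - w 0%N z)) (v j))
    (filterI (ae_L2D (v 0%N) (toL2 (fun z => l z - w 0%N z))) (toL2_ae (Lplw 0%N))).
  by move=> z wz -> [-> ->] _; rewrite !wz [v 0%N z + _]addrC subrK.
Qed.

Lemma L2_complete (u : nat -> L2 R) :
  (forall e : R, 0 < e ->
    exists N, forall m n, (N <= m)%N -> (N <= n)%N -> `|u m - u n| <= e) ->
  exists l : L2 R, forall e : R, 0 < e ->
    exists N, forall n, (N <= n)%N -> `|u n - l| <= e.
Proof.
move=> cu.
have /choice[phi hphi] (j : nat) : exists N, forall m n, (N <= m)%N -> (N <= n)%N ->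
    `|u m - u n| <= 2^-1 ^+ j.+1.
  by apply: cu; rewrite exprn_gt0.
have vd j : `|u (phi j.+1) - u (phi j)| <= 2^-1 ^+ j.
  (* [phi] need not be increasing, so consecutive terms are compared through the larger of the two
     indices. *)
  pose M := maxn (phi j) (phi j.+1).
  rewrite (_ : _ - _ = (u (phi j.+1) - u M) + (u M - u (phi j))); last by rewrite addrA subrK.
  apply: le_trans (ler_normD _ _) _.
  rewrite (_ : 2^-1 ^+ j = 2^-1 ^+ j.+1 + 2^-1 ^+ j.+1 :> R); last by rewrite exprS; field.
  apply: lerD; last by apply: hphi; rewrite ?leq_maxl.
  apply: (@le_trans _ _ (2^-1 ^+ j.+2)); first by apply: hphi; rewrite ?leq_maxr.
  by rewrite [leLHS]exprS ler_piMl ?exprn_ge0// invf_le1// ler1n.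
have [l hl] := L2_cvg_fast vd.
exists l => e e0.
have [j hj] : exists j, 2^-1 ^+ j.+1 + 2 * 2^-1 ^+ j <= e.
  have : (fun j => 2^-1 ^+ j : R) @ \oo --> (0 : R).
    by apply: cvg_expr; rewrite ger0_norm// invf_lt1// ltr1n.
  move=> /cvgr0Pnorm_le /(_ (e / 3)) [|j _ hj]; first by rewrite divr_gt0.
  exists j; have := hj j (leqnn j); rewrite /= ger0_norm ?exprn_ge0// => h.
  have h0 : 0 <= 2^-1 ^+ j :> R by exact: exprn_ge0.
  rewrite exprS; lra.
exists (phi j) => n jn.
rewrite (_ : u n - l = (u n - u (phi j)) + (u (phi j) - l)); last by rewrite addrA subrK.
apply: le_trans (ler_normD _ _) _; apply: le_trans hj; apply: lerD => //.
exact: hphi.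
Qed.

End Completeness.

(** * The exponentials *)

Section Characters.
Variable R : realType.
Implicit Types (x y : L2 R) (z : circle R) (m n : int).
Local Notation mu := (@mcircle R).
Local Notation leb := (@lebesgue_measure R).
Local Notation I2pi := `[0, 2 * pi[%classic.

Lemma pi2_gt0 : 0 < 2 * pi :> R.
Proof. by rewrite mulr_gt0 ?pi_gt0. Qed.

Lemma normc_circle z : normc (sval z) = 1.
Proof. exact/eqP/(valP z). Qed.

Lemma circle_neq0 z : sval z != 0.
Proof.
apply/eqP => z0; have := normc_circle z; rewrite z0 normc0 => /esym/eqP.
by rewrite oner_eq0.
Qed.

Lemma conjc_circle z : conjc (sval z) = (sval z)^-1.
Proof.
apply: (mulfI (circle_neq0 z)); rewrite mul_conjc normc_circle expr1n mulfV//.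
exact: circle_neq0.
Qed.

Lemma conjc_zpow z n : conjc (sval z ^ n) = sval z ^ (- n).
Proof.
have h (k : nat) : conjc (sval z ^+ k) = (sval z ^+ k)^-1.
  by rewrite -exprVn -conjc_circle; elim: k => [|k IH];
    rewrite ?expr0 ?conjc1// !exprS conjcM IH.
case: n => k; first by rewrite -exprnN h.
by rewrite NegzE opprK -[LHS]/(conjc (sval z ^- k.+1)) -h conjcK.
Qed.

Lemma normc_zpow z n : normc (sval z ^ n) = 1.
Proof.
apply/eqP; rewrite -(@pexpr_eq1 _ _ 2) ?normc_ge0//; apply/eqP/(@complexI R).
by rewrite -mul_conjc conjc_zpow -expfzDr ?circle_neq0// subrr.
Qed.

Lemma zpow_expi n (t : R) :
  sval (expi t) ^ n = cos (n%:~R * t) +i* sin (n%:~R * t).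
Proof.
have h (k : nat) : sval (expi t) ^+ k = cos (k%:R * t) +i* sin (k%:R * t).
  elim: k => [|k IH]; first by rewrite expr0 mul0r cos0 sin0.
  rewrite exprS IH -natr1 mulrDl mul1r addrC cosD sinD /=.
  by apply/eqP; rewrite eq_complex /=; apply/andP; split; apply/eqP; ring.
case: n => k; first exact: h.
have := conjc_zpow (expi t) k.+1; rewrite NegzE => <-.
by rewrite [_ ^ _]h /= mulrNz mulNr cosN sinN.
Qed.

Lemma measurable_circle d' (T : measurableType d') (u : circle R -> T) :
  measurable_fun [set: measurableTypeR R] (u \o @expi R) -> measurable_fun [set: circle R] u.
Proof.
move=> mu' _ B mB; rewrite setTI.
by have := mu' measurableT B mB; rewrite setTI.
Qed.

Lemma cmeasurable_zpow n : cmeasurable (fun z : circle R => sval z ^ n).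
Proof.
split; apply: measurable_circle.
- rewrite (_ : _ \o _ = fun t : R => cos (n%:~R * t)).
    apply: continuous_measurable_fun => t; apply: continuous_comp.
      exact: mulrl_continuous.
    exact: continuous_cos.
  by apply/funext => t /=; rewrite (zpow_expi n t).
- rewrite (_ : _ \o _ = fun t : R => sin (n%:~R * t)).
    apply: continuous_measurable_fun => t; apply: continuous_comp.
      exact: mulrl_continuous.
    exact: continuous_sin.
  by apply/funext => t /=; rewrite (zpow_expi n t).
Qed.

Lemma ess_bounded_zpow n : ess_bounded (fun z : circle R => sval z ^ n) 1.
Proof.
by split; [exact: cmeasurable_zpow|apply: nearW => z; rewrite normc_zpow].
Qed.

Lemma ge0_integral_mcircle (f : circle R -> \bar R) :
  measurable_fun [set: circle R] f -> (forall z, (0 <= f z)%E) ->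
  (\int[mu]_z f z = ((2 * pi)^-1)%:E * \int[leb]_(t in I2pi) f (expi t))%E.
Proof.
move=> mf f0; rewrite ge0_integral_mscale//=; congr (_ * _)%E.
rewrite ge0_integral_pushforward//; [|exact: measurable_expi..].
rewrite preimage_setT /=.
have mfe : measurable_fun [set: measurableTypeR R] (f \o @expi R).
  exact: measurableT_comp mf (@measurable_expi R).
(* The restricted measure does not charge the complement of [[0, 2 * pi[], and it agrees with
   Lebesgue measure on subsets of this interval. *)
transitivity (\int[mrestr leb (measurable_itv `[0%R, (2 * pi)%R[)]_(x in
    [set: measurableTypeR R] `\` ~` I2pi) f (expi x))%E.
  apply: ge0_negligible_integral => //.
  - exact: measurableC.
  - by rewrite /= /mrestr setICl measure0.
by rewrite setTD setCK; apply: eq_measure_integral => A mA AI; rewrite /= /mrestr setIidl.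
Qed.

Lemma integrable_expi (u : circle R -> R) :
  mu.-integrable [set: circle R] (EFin \o u) -> leb.-integrable I2pi (EFin \o (u \o @expi R)).
Proof.
move=> ui; have /measurable_EFinP mu' := measurable_int _ ui.
apply/integrableP; split.
  have mue : measurable_fun [set: measurableTypeR R] (u \o @expi R).
    exact: measurableT_comp mu' (@measurable_expi R).
  by apply/measurable_EFinP; exact: measurable_funS mue.
have /integrableP[_] := ui; rewrite ge0_integral_mcircle//; last first.
  by apply/measurable_EFinP; exact: measurableT_comp.
move=> h; rewrite ltNge leye_eq; apply/negP => /eqP e; move: h; rewrite /= e.
by rewrite gt0_muley ?ltxx// lte_fin invr_gt0 pi2_gt0.
Qed.

Lemma integral_mcircle (u : circle R -> R) : mu.-integrable [set: circle R] (EFin \o u) ->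
  (\int[mu]_z (u z)%:E = ((2 * pi)^-1)%:E * \int[leb]_(t in I2pi) (u (expi t))%:E)%E.
Proof.
move=> ui; have mu' := measurable_int _ ui.
have li := integrable_expi ui.
rewrite integralE [in RHS]integralE muleBr//; last first.
  by rewrite fin_num_adde_defr// (integrable_pos_fin_num _ li).
congr (_ - _)%E; rewrite ge0_integral_mcircle//; try exact: measurable_funepos;
  try exact: measurable_funeneg.
- by congr (_ * _)%E; apply: eq_integral => t _; rewrite !funeposE.
- by congr (_ * _)%E; apply: eq_integral => t _; rewrite !funenegE.
Qed.

(** Fundamental theorem of calculus: the antiderivatives sin(kt)/k and -cos(kt)/k take equal values
    at both ends. The values at [k * (2 * pi)] are hypotheses because, for an integer, they are read
    off from the powers of [sval (expi (2 * pi)) = 1]. *)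
Lemma integral_cos_sin (k : R) : k != 0 -> sin (k * (2 * pi)) = 0 -> cos (k * (2 * pi)) = 1 ->
  (\int[leb]_(t in I2pi) (cos (k * t))%:E = 0 /\
   \int[leb]_(t in I2pi) (sin (k * t))%:E = 0)%E.
Proof.
move=> k0 s0 c1.
have ck : continuous (fun t : R => k * t) by move=> t; exact: mulrl_continuous.
have cc : continuous (fun t : R => cos (k * t)).
  by move=> t; apply: continuous_comp; [exact: ck|exact: continuous_cos].
have cs : continuous (fun t : R => sin (k * t)).
  by move=> t; apply: continuous_comp; [exact: ck|exact: continuous_sin].
have dk (t : R) : is_derive t (1 : R) (fun t : R => k * t) k.
  by apply: is_derive_eq; rewrite [LHS]mulr1.
have FTC (f F : R -> R) : continuous f -> continuous F ->
    (forall t, is_derive t (1 : R) F (f t)) -> F (2 * pi) = F 0 ->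
    (\int[leb]_(t in I2pi) (f t)%:E = 0)%E.
  move=> cf cF dF FE.
  rewrite integral_itv_bndo_bndc; last first.
    have mf := continuous_measurable_fun cf.
    by apply/measurable_EFinP; exact: measurable_funS mf.
  rewrite (@continuous_FTC2 _ f F)//.
  - by rewrite FE subee.
  - exact: pi2_gt0.
  - exact: continuous_subspaceT.
  - split.
    + by move=> t _; have [] := dF t.
    + exact: cvg_at_right_filter (cF 0).
    + exact: cvg_at_left_filter (cF (2 * pi)).
  - by move=> t _; rewrite derive1E; have [_] := dF t.
split.
- apply: (@FTC _ (fun t => k^-1 * sin (k * t))) => //.
  + by move=> t; apply: cvgMr; exact: cs.
  + move=> t; have := is_deriveZ k^-1 (is_derive1_comp (is_derive_sin (k * t)) (dk t)).
    by move=> h; apply: is_derive_eq h _; rewrite /GRing.scale/= mulrCA mulVf ?mulr1.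
  + by rewrite s0 !mulr0 sin0 mulr0.
- apply: (@FTC _ (fun t => - k^-1 * cos (k * t))) => //.
  + by move=> t; apply: cvgMr; exact: cc.
  + move=> t; have := is_deriveZ (- k^-1) (is_derive1_comp (is_derive_cos (k * t)) (dk t)).
    by move=> h; apply: is_derive_eq h _; rewrite /GRing.scale/= !mulNr mulrN opprK
      mulrCA mulVf// mulr1.
  + by rewrite c1 mulr0 cos0.
Qed.

Lemma cintegral_zpow n : n != 0 -> cintegral (fun z : circle R => sval z ^ n) = 0.
Proof.
move=> n0.
have [i1 i2] : cintegrable (fun z : circle R => sval z ^ n).
  by apply: (@cintegrable_bounded _ _ 1); [exact: cmeasurable_zpow|
    move=> z; rewrite normc_zpow].
have := zpow_expi n (2 * pi); have -> : sval (expi (2 * pi)) = 1 :> R[i].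
  by rewrite /= mulr_natl cos2pi sin2pi.
rewrite exp1rz => /eqP; rewrite eq_complex /= => /andP[/eqP/esym c1 /eqP/esym s0].
have [h1 h2] := @integral_cos_sin n%:~R (ltac:(by rewrite intr_eq0)) s0 c1.
rewrite /cintegral /Rintegral (integral_mcircle i1) (integral_mcircle i2).
under eq_integral do rewrite zpow_expi /=.
under [X in _ +i* fine (_ * X)]eq_integral do rewrite zpow_expi /=.
by rewrite h1 h2 mule0.
Qed.

Definition chi n : L2 R := toL2 (fun z => sval z ^ n).

Lemma Lp2_bounded (f : circle R -> R[i]) (M : R) : cmeasurable f ->
  (forall z, normc (f z) <= M) -> Lp 2%:E f.
Proof.
move=> mf fM; apply: integrable_Lp2 => //.
apply: (@integrable_bounded _ _ (M ^+ 2)).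
  by apply: measurable_funX; exact: cmeasurable_normc.
move=> z; rewrite ger0_norm ?sqr_ge0// lerXn2r ?nnegrE ?normc_ge0//.
by rewrite (le_trans (normc_ge0 _) (fM z)).
Qed.

Lemma chi_ae n : {ae mu, forall z, chi n z = sval z ^ n}.
Proof.
apply: toL2_ae; apply: (@Lp2_bounded _ 1); first exact: cmeasurable_zpow.
by move=> z; rewrite normc_zpow.
Qed.

Lemma fourier_inner x n : fourier x n = inner x (chi n).
Proof.
apply: ae_cintegral; last 1 first.
- by apply: filterS (chi_ae n) => z ->; rewrite conjc_zpow.
- by apply: cmeasurableM; [exact: L2_cmeasurable|exact: cmeasurable_zpow].
- exact/cintegrable_measurable/cintegrable_inner.
Qed.

Lemma mulL2_zpow_chi m n : mulL2 (fun z => sval z ^ m) (chi n) = chi (m + n).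
Proof.
apply: L2_ae_eq.
apply: filterS3 (mulL2_ae (chi n) (ess_bounded_zpow m)) (chi_ae n) (chi_ae (m + n)).
by move=> z -> -> ->; rewrite expfzDr ?circle_neq0.
Qed.

Lemma fourier_mulL2_zpow m n x :
  fourier (mulL2 (fun z => sval z ^ m) x) n = fourier x (n - m).
Proof.
rewrite !fourier_inner (inner_mulL2 _ _ (ess_bounded_zpow m)); congr inner.
rewrite addrC -mulL2_zpow_chi; congr mulL2; apply/funext => z; exact: conjc_zpow.
Qed.

Lemma fourier_chi m n : fourier (chi m) n = (m == n)%:R.
Proof.
have -> : fourier (chi m) n = cintegral (fun z : circle R => sval z ^ (m - n)).
  apply: ae_cintegral.
  - by apply: cmeasurableM; [exact: L2_cmeasurable|exact: cmeasurable_zpow].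
  - exact: cmeasurable_zpow.
  - by apply: filterS (chi_ae m) => z ->; rewrite expfzDr ?circle_neq0.
have [->|mn] := eqVneq m n; last by rewrite cintegral_zpow// subr_eq0.
rewrite subrr /cintegral /= !Rintegral_cst// mul0r.
by rewrite [X in fine X]mcircle_setT mulr1.
Qed.

End Characters.

(** * Completeness of the exponentials *)

Section StepPolynomials.
Variable R : realType.
Implicit Types (t a y : R).

Lemma bernoulli_lower y m : 0 <= y <= 1 -> 1 - m%:R * y <= (1 - y) ^+ m.
Proof.
move=> /andP[y0 y1]; elim: m => [|m IH]; first by rewrite mul0r subr0 expr0.
have h : (1 - y) * (1 - m%:R * y) <= (1 - y) * (1 - y) ^+ m by rewrite ler_wpM2l// subr_ge0.
rewrite exprS; apply: le_trans h; rewrite -natr1.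
have : 0 <= m%:R * (y * y) by rewrite mulr_ge0// mulr_ge0.
lra.
Qed.

(** The quotient-free form of (1 - y)^m <= 1 / (1 + m y), by induction from (1 - y)(1 + (m + 1) y)
    <= 1 + m y. *)
Lemma bernoulli_upper y m : 0 <= y <= 1 -> (1 - y) ^+ m * (1 + m%:R * y) <= 1.
Proof.
move=> /andP[y0 y1]; elim: m => [|m IH]; first by rewrite mul0r addr0 expr0 mulr1.
apply: le_trans IH; rewrite exprSr -mulrA ler_wpM2l ?exprn_ge0 ?subr_ge0//.
rewrite -natr1; have : 0 <= (m%:R + 1) * (y * y) by rewrite mulr_ge0// ?mulr_ge0// addr_ge0.
lra.
Qed.

(** With a = b^2, [bernoulli_upper] at y = 1 - b gives n b^n <= 1 / (1 - b), hence n a^n <= b^n / (1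
    - b). *)
Lemma cvg_natr_expr a : 0 <= a < 1 -> n%:R * a ^+ n @[n --> \oo] --> (0 : R).
Proof.
move=> /andP[a0 a1]; pose b := Num.sqrt a.
have b0 : 0 <= b by exact: sqrtr_ge0.
have b1 : b < 1 by rewrite -sqrtr1 ltr_sqrt.
apply: (@squeeze_cvgr _ _ _ _ (fun=> 0) (fun n => (1 - b)^-1 * b ^+ n)).
- apply: nearW => n; rewrite mulr_ge0 ?exprn_ge0//=.
  rewrite -(sqr_sqrtr a0) -/b exprAC expr2 mulrA ler_wpM2r ?exprn_ge0//.
  rewrite -[leRHS]mul1r ler_pdivlMr ?subr_gt0//.
  have : b ^+ n * (1 + n%:R * (1 - b)) <= 1.
    by have := @bernoulli_upper (1 - b) n; rewrite subKr; apply; rewrite subr_ge0 (ltW b1) gerBl b0.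
  apply: le_trans; by rewrite [n%:R * _]mulrC -mulrA ler_wpM2l ?exprn_ge0// lerDr.
- exact: cvg_cst.
- rewrite -(mulr0 (1 - b)^-1); apply: cvgMr; apply: cvg_expr.
  by rewrite ger0_norm.
Qed.

(* With [s = 1 - t], the product [n 2^n s^n = n (2 s)^n] tends to [0] if
   [s < 1/2] and is at least [n] if [s >= 1/2]; by Bernoulli's inequalities
   [step_poly n] thus tends to the indicator of [t > 1/2]. *)
Definition step_poly (n : nat) t := (1 - (1 - t) ^+ n) ^+ (n * 2 ^ n).

Lemma step_poly_itv n t : 0 <= t <= 1 -> 0 <= step_poly n t <= 1.
Proof.
move=> /andP[t0 t1]; rewrite /step_poly.
have h0 : 0 <= (1 - t) ^+ n by rewrite exprn_ge0// subr_ge0.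
have h1 : (1 - t) ^+ n <= 1 by rewrite exprn_ile1 ?subr_ge0// gerBl.
by rewrite exprn_ge0 ?subr_ge0// exprn_ile1 ?subr_ge0// gerBl.
Qed.

Lemma cvg_step_poly t : 0 <= t <= 1 ->
  step_poly n t @[n --> \oo] --> ((1 / 2 < t)%R%:R : R).
Proof.
move=> t01; have /andP[t0 t1] := t01.
have s01 n : 0 <= (1 - t) ^+ n <= 1.
  by rewrite exprn_ge0 ?subr_ge0//= exprn_ile1 ?subr_ge0// gerBl.
have [lt|ge] := ltP (1 / 2) t.
- apply: (@squeeze_cvgr _ _ _ _ (fun n => 1 - n%:R * (2 * (1 - t)) ^+ n) (fun=> 1)).
  + apply: nearW => n; have /andP[_ ->] := step_poly_itv n t01.
    rewrite andbT; apply: le_trans (bernoulli_lower (n * 2 ^ n) (s01 n)).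
    by rewrite exprMn natrM natrX mulrA.
  + rewrite -[X in _ --> X]subr0; apply: cvgB; first exact: cvg_cst.
    apply: cvg_natr_expr; lra.
  + exact: cvg_cst.
(* At t = 1/2 the base 2 (1 - t) equals 1, which still suffices for the bound 1 / (n + 1); so the
   limit there is 0. *)
- apply: (@squeeze_cvgr _ _ _ _ (fun=> 0) (fun n => n.+1%:R^-1)).
  + apply: nearW => n; have /andP[-> _] := step_poly_itv n t01.
    rewrite andTb -[leRHS]mul1r ler_pdivlMr// /step_poly.
    apply: le_trans (bernoulli_upper (n * 2 ^ n) (s01 n)).
    rewrite ler_wpM2l ?exprn_ge0 ?subr_ge0//; first by have /andP[] := s01 n.
    rewrite -natr1 addrC lerD2l natrM natrX -mulrA -exprMn ler_peMr//.
    by apply: exprn_ege1; lra.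
  + exact: cvg_cst.
  + exact: cvg_harmonic.
Qed.

End StepPolynomials.

(** * Functions with vanishing integrals over small balls *)

Section LocallyNull.
Variable R : realType.
Local Notation leb := (@lebesgue_measure R).

(** At a Lebesgue point x the mean of |u - u(x)| over small balls tends to 0. It is at least the
    modulus of the mean of u - u(x), which is |u(x)| because u itself has mean zero there. *)
Lemma lebesgue_ae0 (u : R -> R) (a b : R) : leb.-integrable setT (EFin \o u) ->
  (forall x, a < x < b -> exists2 r0 : R, 0 < r0 &
    forall r, 0 < r < r0 -> (\int[leb]_(y in ball x r) (u y)%:E = 0)%E) ->
  {ae leb, forall x, a < x < b -> u x = 0}.
Proof.
move=> ui u0.
have /lebesgue_differentiation[N [mN N0 hN]] := open_integrable_locally openT ui.
exists N; split => // x /=; apply: contra_notP => xN xab.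
have hx : lebesgue_pt u x by apply: contra_notP xN => /hN.
have [r0 r00 hr] := u0 x xab.
apply/eqP; rewrite -normr_le0 -lee_fin.
have le_davg : \forall r \near (0 : R)^'+, (`|u x|%:E <= davg u x r)%E.
  near=> r.
  have rgt0 : 0 < r by near: r; exact: nbhs_right_gt.
  have rr0 : r < r0 by near: r; exact: nbhs_right_lt.
  have r20 : 0 < r *+ 2 by rewrite pmulrn_lgt0.
  have mB : measurable (ball x r : set R) by exact: measurable_ball.
  have muB : leb (ball x r) = (r *+ 2)%:E by rewrite lebesgue_measure_ball// ltW.
  have uB : leb.-integrable (ball x r) (EFin \o u).
    by apply: integrableS ui => //; exact: measurableT.
  have cB : leb.-integrable (ball x r) (EFin \o cst (u x)).
    apply/integrableP; split; first exact/measurable_EFinP/measurable_cst.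
    apply: (@le_lt_trans _ _ (`|u x|%:E * leb (ball x r))%E); last by rewrite muB -EFinM ltry.
    by rewrite -integral_cst.
  rewrite /davg /iavg muB inver mulrn_eq0 /= (gt_eqF rgt0).
  apply: (@le_trans _ _ (((r *+ 2)^-1)%:E * `|\int[leb]_(y in ball x r) (u y - u x)%:E|))%E.
    have -> : (\int[leb]_(y in ball x r) (u y - u x)%:E = - (u x * (r *+ 2))%:E)%E.
      under eq_integral do rewrite EFinB.
      rewrite integralB_EFin// (hr r) ?rgt0// sub0e; congr (- _)%E.
      by rewrite (integral_cst leb mB (u x)%:E) [X in (_ * X)%E]muB -EFinM.
    rewrite -EFinN /= -EFinM lee_fin normrN normrM (ger0_norm (ltW r20)).
    by rewrite mulrCA mulVf ?mulr1// gt_eqF.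
  rewrite lee_wpmul2l// ?lee_fin ?invr_ge0 ?(ltW r20)//.
  apply: le_abse_integral => //; apply/measurable_EFinP; apply: measurable_funB.
    have mub := measurable_int _ uB; exact/measurable_EFinP.
  exact: measurable_cst.
exact: (cvge_ge le_davg hx).
Unshelve. all: by end_near. Qed.

End LocallyNull.

(** * Uniqueness of Fourier coefficients *)

Section Uniqueness.
Variable R : realType.
Implicit Types (f g : circle R -> R[i]) (u : circle R -> R) (n : int) (c : R[i]).
Local Notation mu := (@mcircle R).
Local Notation leb := (@lebesgue_measure R).
Local Notation I2pi := `[0, 2 * pi[%classic.

(* The multipliers of the space of integrable functions with vanishing Fourier
   coefficients form an algebra stable under bounded pointwise limits. *)
Definition null_coefs g :=
  cintegrable g /\ forall n, cintegral (fun z => sval z ^ n * g z) = 0.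

Definition multiplier f := [/\ cmeasurable f, exists M, forall z, normc (f z) <= M &
  forall g, null_coefs g -> null_coefs (fun z => f z * g z)].

Lemma cintegrable_zpowM g n : cintegrable g -> cintegrable (fun z => sval z ^ n * g z).
Proof.
apply: (@cintegrable_mulbounded _ _ _ 1); first exact: cmeasurable_zpow.
by move=> z; rewrite normc_zpow.
Qed.

Lemma multiplier_cst c : multiplier (cst c).
Proof.
split; [exact: cmeasurable_cst|by exists (normc c)|move=> g [gi g0]; split].
  exact: cintegrableZ.
move=> n; under [X in cintegral X]eq_fun do rewrite mulrCA.
by rewrite cintegralZ ?g0 ?mulr0//; exact: cintegrable_zpowM.
Qed.

Lemma multiplier_zpow n : multiplier (fun z => sval z ^ n).
Proof.
split; [exact: cmeasurable_zpow|by exists 1 => z; rewrite normc_zpow|].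
move=> g [gi g0]; split; first exact: cintegrable_zpowM.
move=> k; under [X in cintegral X]eq_fun => z do rewrite mulrA -expfzDr ?circle_neq0//.
exact: g0.
Qed.

Lemma multiplierM f1 f2 : multiplier f1 -> multiplier f2 -> multiplier (fun z => f1 z * f2 z).
Proof.
move=> [m1 [M1 b1] h1] [m2 [M2 b2] h2]; split.
- exact: cmeasurableM.
- exists (M1 * M2) => z; rewrite normcM ler_pM ?normc_ge0//.
- move=> g /h2/h1[gi g0]; split; first by under eq_fun do rewrite -mulrA.
  by move=> n; under [X in cintegral X]eq_fun do rewrite -(mulrA (f1 _)).
Qed.

Lemma multiplierD f1 f2 : multiplier f1 -> multiplier f2 -> multiplier (fun z => f1 z + f2 z).
Proof.
move=> [m1 [M1 b1] h1] [m2 [M2 b2] h2]; split.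
- exact: cmeasurableD.
- by exists (M1 + M2) => z; rewrite (le_trans (le_normcD _ _))// lerD.
- move=> g g0; have [i1 e1] := h1 g g0; have [i2 e2] := h2 g g0; split.
    by under eq_fun do rewrite mulrDl; exact: cintegrableD.
  move=> n; under [X in cintegral X]eq_fun do rewrite mulrDl mulrDr.
  by rewrite cintegralD ?e1 ?e2 ?addr0//; exact: cintegrable_zpowM.
Qed.

Definition rmultiplier u := multiplier (fun z => (u z)%:C).

Lemma rmultiplier_cst (a : R) : rmultiplier (cst a).
Proof. exact: (multiplier_cst a%:C). Qed.

Lemma rmultiplierM u v : rmultiplier u -> rmultiplier v -> rmultiplier (fun z => u z * v z).
Proof.
by move=> hu hv; rewrite /rmultiplier; under eq_fun do rewrite rmorphM; exact: multiplierM.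
Qed.

Lemma rmultiplierB u v : rmultiplier u -> rmultiplier v -> rmultiplier (fun z => u z - v z).
Proof.
move=> hu hv; have := multiplierD hu (multiplierM (multiplier_cst (-1)) hv).
rewrite /rmultiplier; congr multiplier; apply/funext => z /=.
by rewrite mulN1r rmorphB.
Qed.

Lemma rmultiplierX u k : rmultiplier u -> rmultiplier (fun z => u z ^+ k).
Proof.
move=> hu; elim: k => [|k IH]; first exact: rmultiplier_cst.
by under eq_fun do rewrite exprS; exact: rmultiplierM.
Qed.

(** Dominated convergence. A real factor does not mix real and imaginary parts, so the limit is
    taken separately in the two parts of [sval z ^ n * g z], each dominated by its own absolute
    value. *)
Lemma rmultiplier_lim (v : nat -> circle R -> R) u :
  (forall k, rmultiplier (v k)) -> (forall k z, 0 <= v k z <= 1) ->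
  (forall z, v k z @[k --> \oo] --> u z) -> rmultiplier u.
Proof.
move=> mv v01 vu.
have mvk k : measurable_fun [set: circle R] (v k) by have [[]] := mv k.
have mu' : measurable_fun [set: circle R] u by exact: measurable_fun_cvg mvk _.
have u1 z : `|u z| <= 1.
  have cz := vu z.
  have u0 : 0 <= u z.
    by apply: (ler_cvg_to (cvg_cst 0) cz); apply: nearW => k; have /andP[] := v01 k z.
  rewrite ger0_norm//.
  by apply: (ler_cvg_to cz (cvg_cst (1 : R))); apply: nearW => k; have /andP[] := v01 k z.
have mu0 : cmeasurable (fun z => (u z)%:C : R[i]) by exact: cmeasurable_real.
split => //; first by exists 1 => z; rewrite normc_real.
move=> g g0; have [gi _] := g0.
have ugi : cintegrable (fun z => (u z)%:C * g z).
  by apply: (cintegrable_mulbounded mu0 _ gi) => z; rewrite normc_real.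
split => // n.
have hi := cintegrable_zpowM n gi.
have lim0 (h : circle R -> R) : mu.-integrable [set: circle R] (EFin \o h) ->
    (forall k, \int[mu]_z (v k z * h z) = 0) -> \int[mu]_z (u z * h z) = 0.
  move=> hh vh0; have /measurable_EFinP mh := measurable_int _ hh.
  have [|||||_ _] := @dominated_convergence _ _ _ mu setT measurableT
    (fun k z => (v k z * h z)%:E) (fun z => (u z * h z)%:E) (fun z => `|h z|%:E).
  - by move=> k; apply/measurable_EFinP; exact: measurable_funM.
  - by apply/measurable_EFinP; exact: measurable_funM.
  - apply: nearW => z _; apply: cvg_EFin; first exact: nearW.
    exact: cvgMl (vu z).
  - exact: (integrable_abse hh).
  - apply: nearW => z k _ /=; rewrite lee_fin normrM ler_piMl//.
    by have /andP[v0 v1] := v01 k z; rewrite ger0_norm.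
  move=> cv; rewrite /Rintegral; rewrite -(cvg_lim _ cv)//=.
  suff -> : (fun k => \int[mu]_z (v k z * h z)%:E)%E = cst 0%E by rewrite lim_cst.
  apply/funext => k; rewrite -[LHS]fineK ?(vh0 k)//.
    by have := vh0 k; rewrite /Rintegral => ->.
  apply: integrable_fin_num => //; apply: le_integrable (integrable_abse hh) => //.
    by apply/measurable_EFinP; exact: measurable_funM.
  move=> z _ /=; rewrite lee_fin normr_id normrM ler_piMl//.
  by have /andP[v0 v1] := v01 k z; rewrite ger0_norm.
have e0 w : (forall z, `|w z| <= 1) -> cintegral (fun z => sval z ^ n * ((w z)%:C * g z)) =
    \int[mu]_z (w z * complex.Re (sval z ^ n * g z)) +i*
    \int[mu]_z (w z * complex.Im (sval z ^ n * g z)).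
  move=> _; rewrite /cintegral; congr (_ +i* _); apply: eq_Rintegral => z _;
  by rewrite mulrCA ?Re_realM ?Im_realM.
have v1 k z : `|v k z| <= 1.
  by have /andP[v0 vk1] := v01 k z; rewrite ger0_norm.
have [hi1 hi2] := hi.
have vn k : \int[mu]_z (v k z * complex.Re (sval z ^ n * g z)) = 0 /\
            \int[mu]_z (v k z * complex.Im (sval z ^ n * g z)) = 0.
  have [_ _ /(_ _ g0)[_ /(_ n)]] := mv k.
  by rewrite e0//; move/eqP; rewrite eq_complex /= => /andP[/eqP-> /eqP->].
rewrite e0// (lim0 _ hi1); last by move=> k; have [] := vn k.
by rewrite (lim0 _ hi2)//; move=> k; have [] := vn k.
Qed.

Lemma rmultiplier_step u : rmultiplier u -> (forall z, 0 <= u z <= 1) ->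
  rmultiplier (fun z => (1 / 2 < u z)%R%:R).
Proof.
move=> mu' u01; apply: (@rmultiplier_lim (fun k z => step_poly k (u z))).
- move=> k; rewrite /step_poly; apply: rmultiplierX; apply: rmultiplierB.
    exact: rmultiplier_cst.
  apply: rmultiplierX; apply: rmultiplierB => //; exact: rmultiplier_cst.
- by move=> k z; exact: step_poly_itv.
- by move=> z; exact: cvg_step_poly.
Qed.

(* Chosen to exceed [1 / 2] exactly on the arc of radius [r] around [expi x]. *)
Definition arc_fun (x r : R) (z : circle R) : R :=
  1 / 2 + (complex.Re (sval z * conjc (sval (expi x))) - cos r) / 4.

Lemma arc_fun_expi x r t : arc_fun x r (expi t) = 1 / 2 + (cos (t - x) - cos r) / 4.
Proof. by rewrite /arc_fun /= cosB mulrN opprK. Qed.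

(** A difference of two numbers in [-1, 1] lies in [-2, 2]: the divisor 4 keeps the function in
    [0, 1], where the step polynomials converge. *)
Lemma arc_fun_itv x r z : 0 <= arc_fun x r z <= 1.
Proof.
rewrite /arc_fun; set c := complex.Re _.
have : `|c| <= 1.
  by rewrite (le_trans (normr_Re_le _))// normcM normc_conjc !normc_circle mulr1.
rewrite ler_norml => /andP[? ?]; have := cos_le1 r; have := cos_geN1 r; lra.
Qed.

(** On the circle, Re(z conj(w)) = (z conj(w) + z^-1 w) / 2 is a trigonometric polynomial of degree
    one; the coefficient 1/8 is this 1/2 times the 1/4 of [arc_fun]. *)
Lemma rmultiplier_arc_fun x r : rmultiplier (arc_fun x r).
Proof.
have [w wE] : exists w : R[i], w = sval (expi x) by eexists.
have := multiplierD (multiplier_cst (1 / 2 - cos r / 4)%:C)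
  (multiplierM (multiplier_cst (1 / 8)%:C)
    (multiplierD (multiplierM (multiplier_zpow 1) (multiplier_cst (conjc w)))
                 (multiplierM (multiplier_zpow (-1)) (multiplier_cst w)))).
rewrite /rmultiplier; congr multiplier; apply/funext => z /=.
rewrite expr1z exprN1 -conjc_circle /arc_fun -wE; case: (sval z) => a b; case: w {wE} => c d.
by apply/eqP; rewrite eq_complex /=; apply/andP; split; apply/eqP; field.
Qed.

(** Cosine decreases strictly on [0, pi], which settles |t - x| <= pi. Beyond pi the distance is
    reflected to 2 pi - |t - x|, which is still at least r because the arc stays away from both ends
    of [[0, 2 * pi[]. *)
Lemma arc_fun_gt x r t : 0 < x < 2 * pi -> 0 < r -> r < x -> r < 2 * pi - x ->
  0 <= t < 2 * pi -> (1 / 2 < arc_fun x r (expi t)) = (`|t - x| < r).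
Proof.
move=> /andP[x0 x2] r0 rx r2x /andP[t0 t2].
rewrite arc_fun_expi.
have -> : (1 / 2 < 1 / 2 + (cos (t - x) - cos r) / 4) = (cos r < cos `|t - x|).
  by rewrite cos_norm; apply/idP/idP => ?; lra.
have rpi : r < pi by lra.
have [dpi|dpi] := leP `|t - x| pi.
  by rewrite ltr_cos// in_itv/= ?normr_ge0 ?dpi// (ltW r0) ltW.
have dr : `|t - x| <= 2 * pi - r by rewrite ler_norml; apply/andP; split; lra.
rewrite -[RHS]negbK -leNgt (ltW (lt_trans rpi dpi)) /=.
apply/negbTE; rewrite -leNgt.
have -> : cos `|t - x| = cos (2 * pi - `|t - x|).
  by rewrite -[RHS]cosN opprB mulr_natl -(cosD2pi (`|t - x| - pi *+ 2)) subrK.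
have [->|ne] := eqVneq (2 * pi - `|t - x|) r; first by [].
apply/ltW; rewrite ltr_cos ?in_itv/=; last 2 first.
- by apply/andP; split; lra.
- by apply/andP; split; lra.
by rewrite lt_neqAle eq_sym ne /=; lra.
Qed.

Lemma null_coefs_Re g : null_coefs g -> {ae mu, forall z, complex.Re (g z) = 0}.
Proof.
move=> g0; have [gi _] := g0; have [g1 _] := gi.
pose h t := (fun t => complex.Re (g (expi t))) \_ I2pi t.
have hi : leb.-integrable setT (EFin \o h).
  rewrite (_ : EFin \o h = (EFin \o ((fun z => complex.Re (g z)) \o @expi R)) \_ I2pi).
    by apply/(integrable_mkcond _ _).1 => //; exact: integrable_expi.
  by apply/funext => t; rewrite /h /= !patchE; case: ifP.
have hball x r : 0 < x < 2 * pi -> 0 < r < Num.min x (2 * pi - x) ->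
    (\int[leb]_(y in ball x r) (h y)%:E = 0)%E.
  move=> x02 /andP[r0]; rewrite lt_min => /andP[rx r2x].
  (* The coefficient of index 0 of [g] times the indicator of an arc is the integral of [g] over
     that arc. *)
  have [_ _ /(_ _ g0)[[ri _] /(_ 0)]] :=
    rmultiplier_step (rmultiplier_arc_fun x r) (arc_fun_itv x r).
  pose ind z : R := (1 / 2 < arc_fun x r z)%R%:R.
  have {}ri : mu.-integrable [set: circle R] (EFin \o (fun z => ind z * complex.Re (g z))).
    by move: ri; congr integrable; apply/funext => z /=; rewrite Re_realM.
  under [X in cintegral X]eq_fun do rewrite expr0z mul1r.
  move/(congr1 (@complex.Re R)) => /=; under eq_Rintegral do rewrite Re_realM.
  rewrite -/ind => r00; have r0E : (\int[mu]_z (ind z * complex.Re (g z))%:E = 0)%E.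
    by rewrite -(fineK (integrable_fin_num measurableT ri)) -[fine _]/(\int[mu]_z _) r00.
  have := integral_mcircle ri; rewrite r0E => /esym/eqP; rewrite mule_eq0.
  rewrite eqe invr_eq0 (gt_eqF (pi2_gt0 R)) /= => /eqP <-.
  rewrite [LHS]integral_mkcond [RHS]integral_mkcond; apply: eq_integral => t _.
  rewrite !patchE /h patchE.
  have -> : (t \in I2pi) = (0 <= t < 2 * pi) by apply/idP/idP; rewrite inE /= in_itv.
  have -> : (t \in (ball x r : set R)) = (`|t - x| < r).
    by apply/idP/idP; rewrite inE /ball /= distrC.
  have [t02|] := boolP (0 <= t < 2 * pi).
    by rewrite /ind arc_fun_gt//; case: ifP; rewrite ?mul1r ?mul0r.
  by case: ifPn.
have {}hae : {ae leb, forall t, 0 < t < 2 * pi -> h t = 0}.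
  apply: lebesgue_ae0 hi _ => x hx; have /andP[x0 x2] := hx.
  exists (Num.min x (2 * pi - x)); first by rewrite lt_min x0 subr_gt0.
  by move=> r; exact: hball.
have mRe : measurable_fun [set: circle R] (EFin \o (fun z => complex.Re (g z))).
  exact: measurable_int g1.
have mRe' : measurable_fun [set: measurableTypeR R] (EFin \o (fun t => complex.Re (g (expi t)))).
  exact: measurableT_comp mRe (@measurable_expi R).
have I0 : (\int[mu]_z `|(complex.Re (g z))%:E| = 0)%E.
  rewrite ge0_integral_mcircle//; last exact: measurableT_comp.
  rewrite -(@integral_itv_obnd_cbnd _ 0); last first.
    by apply: measurableT_comp => //; exact: measurable_funS mRe'.
  apply/eqP; rewrite mule_eq0; apply/orP; right; apply/eqP.
  apply/(ae_eq_integral_abs leb (measurable_itv `]0, 2 * pi[)); first exact: measurable_funS mRe'.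
  have [N [mN N0 hN]] := hae; exists N; split => // t /=; apply: contra_notP => tN.
  rewrite in_itv /= => t02.
  have : h t = 0 by apply: contra_notP tN => ht0; apply: hN => /= /(_ t02).
  rewrite /h patchE mem_set; first by move=> ->.
  by rewrite /= in_itv /=; have /andP[/ltW-> ->] := t02.
have := (ae_eq_integral_abs mu measurableT mRe).1 I0.
by apply: filterS => z /(_ I)[].
Qed.

(** The imaginary part of g is the real part of -i g, and constants are multipliers. *)
Lemma null_coefs_ae0 g : null_coefs g -> {ae mu, forall z, g z = 0}.
Proof.
move=> g0; have [_ _ /(_ g g0) ig] := multiplier_cst (0 +i* (- 1)).
apply: filterS2 (null_coefs_Re g0) (null_coefs_Re ig) => z zr.
rewrite Re_complexM; case: (g z) zr => a b /= ->.
by rewrite mul0r mulN1r opprK add0r => ->.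
Qed.

Lemma fourier_eq0 (x : L2 R) : (forall n, fourier x n = 0) -> x = 0.
Proof.
move=> x0; have nx : null_coefs x.
  split; first exact: L2_cintegrable.
  move=> n; have := x0 (- n); rewrite /fourier opprK => <-.
  by congr cintegral; apply/funext => z; rewrite mulrC.
by apply: L2_ae_eq; apply: filterS2 (null_coefs_ae0 nx) (ae_L20 R) => z -> ->.
Qed.

End Uniqueness.

(** * Fourier series and the projection onto H^2 *)

Section FourierSeries.
Variable R : realType.
Implicit Types (x y w h : L2 R) (n : int) (c : R[i]).

Lemma inner_suml N (F : 'I_N -> L2 R) w : inner (\sum_k F k) w = \sum_k inner (F k) w.
Proof. 
apply: (@big_morph _ _ (fun x : L2 R => inner x w) 0 +%R 0 +%R) => [x y|].
  exact: innerDl.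
exact: inner0l.
 Qed.

Lemma normc_eq0_le c : (forall e : R, 0 < e -> normc c <= e) -> c = 0.
Proof.
move=> h; apply: eq0_normc; apply/eqP; rewrite eq_le normc_ge0 andbT.
by apply/ler_addgt0Pr => e e0; rewrite add0r; exact: h.
Qed.

(** Indexed by [nat]: the exponentials enter as two sequences, of non-negative and of negative
    frequencies, whose series yield the two components of a vector. *)
Definition orthonormal_seq (e : nat -> L2 R) :=
  forall i j, inner (e i) (e j) = (i == j)%:R.

Definition partial_sum (e : nat -> L2 R) x N : L2 R := \sum_(k < N) inner x (e k) *: e k.

Lemma inner_partial_sum e x N w : (forall k, (k < N)%N -> inner (e k) w = 0) ->
  inner (partial_sum e x N) w = 0.
Proof.
by move=> ew; rewrite inner_suml big1// => k _; rewrite innerZl ew ?mulr0.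
Qed.

Lemma partial_sum_coef e x N j : orthonormal_seq e -> (j < N)%N ->
  inner (x - partial_sum e x N) (e j) = 0.
Proof.
move=> oe jN; rewrite innerBl inner_suml (bigD1 (Ordinal jN))//= innerZl oe eqxx mulr1.
rewrite big1 ?addr0 ?subrr// => k kj; rewrite innerZl oe.
by rewrite -val_eqE /= in kj; rewrite (negbTE kj) mulr0.
Qed.

Lemma partial_sum_orth e x N M : orthonormal_seq e -> (M <= N)%N ->
  inner (partial_sum e x M) (x - partial_sum e x N) = 0.
Proof.
move=> oe MN; apply: inner_partial_sum => k kM.
by rewrite innerC partial_sum_coef ?conjc0// (leq_trans kM).
Qed.

Lemma partial_sum_diff e x N M : orthonormal_seq e -> (M <= N)%N ->
  `|partial_sum e x N - partial_sum e x M| ^+ 2 =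
  `|partial_sum e x N| ^+ 2 - `|partial_sum e x M| ^+ 2.
Proof.
move=> oe MN; have o : inner (partial_sum e x M) (partial_sum e x N - partial_sum e x M) = 0.
  have -> : partial_sum e x N - partial_sum e x M =
      (x - partial_sum e x M) - (x - partial_sum e x N).
    by rewrite opprB [RHS]addrC addrA subrK.
  by rewrite innerBr !partial_sum_orth// subrr.
by have := pythagoras o; rewrite addrC subrK => ->; rewrite [RHS]addrC addKr.
Qed.

Lemma bessel e x N : orthonormal_seq e -> `|partial_sum e x N| ^+ 2 <= `|x| ^+ 2.
Proof.
move=> oe; have := pythagoras (partial_sum_orth x oe (leqnn N)).
by rewrite addrC subrK => ->; rewrite lerDl sqr_ge0.
Qed.

(** The squared norms of the partial sums increase, Bessel's inequality bounds them, and their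
    differences are squared distances; so the partial sums are Cauchy. The second property of [y]
    stands in for membership in the closed span of the sequence. *)
Lemma fourier_series e x : orthonormal_seq e -> exists y,
  [/\ forall k, inner (x - y) (e k) = 0,
      forall w, (forall k, inner (e k) w = 0) -> inner y w = 0 &
      forall d : R, 0 < d -> exists N, forall M, (N <= M)%N -> `|partial_sum e x M - y| <= d].
Proof.
move=> oe; pose a N := `|partial_sum e x N| ^+ 2.
have nda : nondecreasing_seq a.
  by move=> m n mn; rewrite -subr_ge0 /a -partial_sum_diff// sqr_ge0.
have ca : cvgn a.
  by apply: nondecreasing_is_cvgn nda _; exists (`|x| ^+ 2) => _ [n _ <-]; exact: bessel.
have [y hy] : exists y : L2 R, forall d : R, 0 < d ->
    exists N, forall M, (N <= M)%N -> `|partial_sum e x M - y| <= d.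
  apply: L2_complete => d d0.
  have /cvgrPdist_le /(_ (d ^+ 2)) := ca.
  case=> [|N _ hN]; first by rewrite exprn_gt0.
  have aN m : (N <= m)%N -> limn a - a m <= d ^+ 2.
    by move=> Nm; rewrite (le_trans (ler_norm _))//; exact: hN.
  have alim m : a m <= limn a by exact: nondecreasing_cvgn_le.
  have key (m n : nat) : (N <= m)%N -> (m <= n)%N -> `|partial_sum e x n - partial_sum e x m| <= d.
    move=> Nm mn; rewrite -(@ler_pXn2r _ 2) ?nnegrE ?(ltW d0)//.
    rewrite partial_sum_diff// (le_trans _ (aN m Nm))// lerD2r; exact: alim.
  exists N => m n Nm Nn; have [mn|/ltnW nm] := leqP m n; last exact: key.
  by rewrite distrC; exact: key.
exists y; split => //.
- move=> k; have e1 : `|e k| = 1.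
    have /(congr1 (@complex.Re R)) := inner_sqr (e k); rewrite oe eqxx /= => /esym/eqP.
    by rewrite sqrp_eq1// => /eqP.
  apply: normc_eq0_le => d /hy[N hN].
  pose M := maxn N k.+1.
  have -> : x - y = (x - partial_sum e x M) + (partial_sum e x M - y) by rewrite addrA subrK.
  rewrite innerDl partial_sum_coef ?leq_maxr// add0r.
  by apply: le_trans (inner_le _ _) _; rewrite e1 mulr1 hN// leq_maxl.
- move=> w ew; apply: normc_eq0_le => d d0.
  have [|N hN] := hy (d / (`|w| + 1)); first by rewrite divr_gt0// ltr_wpDl.
  have -> : inner y w = - inner (partial_sum e x N - y) w.
    by rewrite innerBl inner_partial_sum ?sub0r ?opprK.
  rewrite normcN; apply: le_trans (inner_le _ _) _.
  apply: (@le_trans _ _ (d / (`|w| + 1) * `|w|)); first by rewrite ler_wpM2r// hN.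
  by rewrite mulrAC ler_pdivrMr ?ltr_wpDl// ler_wpM2l ?(ltW d0)// lerDl.
Qed.

Lemma inner_chi m n : inner (chi R m) (chi R n) = (m == n)%:R.
Proof. by rewrite -fourier_inner fourier_chi. Qed.

Lemma fourierD x y n : fourier (x + y) n = fourier x n + fourier y n.
Proof. by rewrite !fourier_inner innerDl. Qed.

Lemma fourierZ c x n : fourier (c *: x) n = c * fourier x n.
Proof. by rewrite !fourier_inner innerZl. Qed.

Lemma orthonormal_chi_nat : orthonormal_seq (fun k => chi R k%:Z).
Proof. by move=> i j; rewrite inner_chi. Qed.

Lemma orthonormal_chi_neg : orthonormal_seq (fun k => chi R (Negz k)).
Proof. by move=> i j; rewrite inner_chi. Qed.

Lemma H2_lin c x y : H2 x -> H2 y -> H2 (c *: x + y).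
Proof. by move=> hx hy n n0; rewrite fourierD fourierZ hx// hy// mulr0 addr0. Qed.

Lemma H2perp_lin c x y : H2perp x -> H2perp y -> H2perp (c *: x + y).
Proof. by move=> hx hy h hh; rewrite innerDl innerZl hx// hy// mulr0 addr0. Qed.

Lemma H2_0 : H2 (0 : L2 R).
Proof. by move=> n _; rewrite fourier_inner inner0l. Qed.

Lemma H2perp_0 : H2perp (0 : L2 R).
Proof. by move=> h _; rewrite inner0l. Qed.

Lemma H2Z c x : H2 x -> H2 (c *: x).
Proof. by move=> hx; rewrite -[c *: x]addr0; exact: H2_lin H2_0. Qed.

Lemma H2perpZ c x : H2perp x -> H2perp (c *: x).
Proof. by move=> hx; rewrite -[c *: x]addr0; exact: H2perp_lin H2perp_0. Qed.

Lemma H2D x y : H2 x -> H2 y -> H2 (x + y).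
Proof. by move=> hx hy; rewrite -[x]scale1r; exact: H2_lin. Qed.

Lemma H2perpD x y : H2perp x -> H2perp y -> H2perp (x + y).
Proof. by move=> hx hy; rewrite -[x]scale1r; exact: H2perp_lin. Qed.

Lemma H2_chi n : 0 <= n -> H2 (chi R n).
Proof. by move=> n0 m m0; rewrite fourier_chi gt_eqF// (lt_le_trans m0). Qed.

Lemma H2perp_chi n : n < 0 -> H2perp (chi R n).
Proof. by move=> n0 h hh; rewrite innerC -fourier_inner hh ?conjc0. Qed.

Lemma H2_sum N (F : 'I_N -> L2 R) : (forall k, H2 (F k)) -> H2 (\sum_k F k).
Proof. by move=> hF; apply: (big_ind (@H2 R)) => //; [exact: H2_0|exact: H2D]. Qed.

Lemma H2perp_sum N (F : 'I_N -> L2 R) : (forall k, H2perp (F k)) -> H2perp (\sum_k F k).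
Proof. by move=> hF; apply: (big_ind (@H2perp R)) => //; [exact: H2perp_0|exact: H2perpD]. Qed.

Definition trig_sum x N : L2 R :=
  partial_sum (fun k => chi R k%:Z) x N + partial_sum (fun k => chi R (Negz k)) x N.

Lemma H2_decomposition x : exists y y', [/\ H2 y, H2perp y', x = y + y' &
  forall d : R, 0 < d -> exists N,
    `|partial_sum (fun k => chi R k%:Z) x N - y| <= d /\
    `|partial_sum (fun k => chi R (Negz k)) x N - y'| <= d].
Proof.
have [y [y1 y2 y3]] := fourier_series x orthonormal_chi_nat.
have [y' [y1' y2' y3']] := fourier_series x orthonormal_chi_neg.
exists y, y'; split.
- by move=> n n0; rewrite fourier_inner y2// => k; rewrite inner_chi gt_eqF// (lt_le_trans n0).
- by move=> h hh; rewrite y2'// => k; rewrite innerC -fourier_inner hh ?conjc0.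
- apply/eqP; rewrite -subr_eq0; apply/eqP/fourier_eq0 => n; rewrite fourier_inner opprD.
  case: n => k.
    by rewrite addrA innerBl y1 y2' ?subr0// => j; rewrite inner_chi.
  by rewrite addrCA addrC innerBl y1' y2 ?subr0// => j; rewrite inner_chi.
- move=> d d0; have [N hN] := y3 d d0; have [N' hN'] := y3' d d0.
  exists (maxn N N'); split; [apply: hN|apply: hN']; [exact: leq_maxl|exact: leq_maxr].
Qed.

Lemma H2_cap_H2perp x : H2 x -> H2perp x -> x = 0.
Proof.
move=> hx /(_ x hx) /eqP; rewrite inner_sqr (inj_eq (@complexI R) _ 0) sqrf_eq0 normr_eq0.
by move/eqP.
Qed.

(** The decomposition supplies a witness, so the choice in [orthogonal_proj] does not fall back on
    its default. *)
Lemma projH2P x : H2 (projH2 x) /\ H2perp (projH2perp x).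
Proof.
have [y [y' [hy hy' e _]]] := H2_decomposition x.
apply: (@xgetPex _ 0 [set y | H2 y /\ orthogonal_compl (@H2 R) (x - y)]).
by exists y; split => //; rewrite e addrC addKr.
Qed.

Lemma projH2_projH2perp x : projH2 x + projH2perp x = x.
Proof. by rewrite addrC subrK. Qed.

Lemma projH2_unique x y y' : H2 y -> H2perp y' -> x = y + y' -> projH2 x = y /\ projH2perp x = y'.
Proof.
move=> hy hy' e; have [h1 h2] := projH2P x.
have d0 : y - projH2 x = projH2perp x - y'.
  have q : projH2perp x = y + y' - projH2 x by rewrite -e.
  by rewrite q addrAC addrK.
have : y - projH2 x = 0.
  apply: H2_cap_H2perp.
    by rewrite addrC -scaleN1r; exact: H2_lin.
  by rewrite d0 addrC -scaleN1r; exact: H2perp_lin.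
move=> /eqP; rewrite subr_eq0 => /eqP yE; split; first by [].
by rewrite /projH2perp -yE e addrC addKr.
Qed.

Lemma projH2_id x : H2 x -> projH2 x = x /\ projH2perp x = 0.
Proof. by move=> hx; apply: projH2_unique; rewrite ?addr0//; exact: H2perp_0. Qed.

Lemma projH2_H2perp x : H2perp x -> projH2 x = 0 /\ projH2perp x = x.
Proof. by move=> hx; apply: projH2_unique; rewrite ?add0r//; exact: H2_0. Qed.

Lemma projH2_lin c x y : projH2 (c *: x + y) = c *: projH2 x + projH2 y /\
  projH2perp (c *: x + y) = c *: projH2perp x + projH2perp y.
Proof.
have [hx hx'] := projH2P x; have [hy hy'] := projH2P y.
apply: projH2_unique; [exact: H2_lin|exact: H2perp_lin|].
by rewrite addrACA -scalerDr !projH2_projH2perp.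
Qed.

Lemma projH2_norm x : `|projH2 x| <= `|x| /\ `|projH2perp x| <= `|x|.
Proof.
have [hx hx'] := projH2P x.
have /pythagoras : inner (projH2 x) (projH2perp x) = 0 by rewrite innerC hx' ?conjc0.
rewrite projH2_projH2perp => e.
by split; rewrite -(@ler_pXn2r _ 2) ?nnegrE// e ?lerDl ?lerDr sqr_ge0.
Qed.

Lemma mulL2B f M x y : ess_bounded f M -> mulL2 f (x - y) = mulL2 f x - mulL2 f y.
Proof. by move=> fM; rewrite (mulL2D _ _ fM) -scaleN1r (mulL2Z _ _ fM) scaleN1r. Qed.

Lemma mulL2_sum f M N (F : 'I_N -> L2 R) : ess_bounded f M ->
  mulL2 f (\sum_k F k) = \sum_k mulL2 f (F k).
Proof.
move=> fM; apply: (big_morph (mulL2 f)) => [x y|]; first exact: mulL2D fM.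
exact: mulL20r fM.
Qed.

Lemma mulL2_chi f M n : ess_bounded f M -> Lp 2%:E f ->
  mulL2 f (chi R n) = mulL2 (fun z => sval z ^ n) (toL2 f).
Proof.
move=> fM f2; apply: L2_ae_eq.
apply: filterS3 (mulL2_ae (chi R n) fM) (chi_ae R n)
  (filterI (mulL2_ae (toL2 f) (ess_bounded_zpow R n)) (toL2_ae f2)) => z.
by move=> -> -> [-> ->]; rewrite mulrC.
Qed.

(** For k >= 0 the product of f with z^k is a forward shift of f and stays in [H2]. A vector of [H2]
    is the limit of its sums over non-negative frequencies, and each coefficient of the product
    depends continuously on the vector. *)
Lemma mulL2_H2 f M x : ess_bounded f M -> analytic f -> H2 x -> H2 (mulL2 f x).
Proof.
move=> fM [f2 fH] hx n n0; rewrite fourier_inner; apply: normc_eq0_le => d d0.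
have M0 : 0 <= `|M| * `|chi R n| by exact: mulr_ge0.
have [y [y' [hy hy' e happ]]] := H2_decomposition x.
have [yx _] := projH2_unique hy hy' e; have [xx _] := projH2_id hx.
have {}yx : y = x by rewrite -yx xx.
have [|N [hN _]] := happ (d / (`|M| * `|chi R n| + 1)); first by rewrite divr_gt0// ltr_wpDl.
pose s := partial_sum (fun k => chi R k%:Z) x N.
have sH : H2 (mulL2 f s).
  rewrite (mulL2_sum _ fM); apply: H2_sum => k; rewrite (mulL2Z _ _ fM); apply: H2Z.
  rewrite (mulL2_chi _ fM f2) => m m0; rewrite fourier_mulL2_zpow fH//.
  by rewrite subr_lt0 (lt_le_trans m0).
have -> : inner (mulL2 f x) (chi R n) = inner (mulL2 f (x - s)) (chi R n).
  by rewrite (mulL2B _ _ fM) innerBl -[in RHS]fourier_inner -[X in _ - X]fourier_inner sH ?subr0//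
    fourier_inner.
apply: le_trans (inner_le _ _) _.
apply: (@le_trans _ _ (`|M| * (d / (`|M| * `|chi R n| + 1)) * `|chi R n|)).
  rewrite ler_wpM2r//; apply: le_trans (mulL2_norm _ fM) _.
  apply: (@le_trans _ _ (`|M| * `|x - s|)); first by rewrite ler_wpM2r// ler_norm.
  by rewrite ler_wpM2l// distrC -[X in _ - X]yx.
rewrite mulrAC mulrCA mulrA ler_pdivrMr ?ltr_wpDl//.
by rewrite ler_wpM2l ?(ltW d0)// lerDl.
Qed.

Lemma ess_bounded_conjc f M : ess_bounded f M -> ess_bounded (fun z : circle R => conjc (f z)) M.
Proof.
by move=> [mf fM]; split; [exact: cmeasurable_conjc|apply: filterS fM => z; rewrite normc_conjc].
Qed.

(** The adjoint of the multiplication is multiplication by the conjugate, which is analytic and so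
    preserves [H2]. *)
Lemma mulL2_H2perp f M x : ess_bounded f M -> coanalytic f -> H2perp x -> H2perp (mulL2 f x).
Proof.
move=> fM cf hx h hh; rewrite (inner_mulL2 _ _ fM); apply: hx.
exact: mulL2_H2 (ess_bounded_conjc fM) cf hh.
Qed.

(** The frequencies of [trig_sum x N] run from -N to N - 1. Thus z^N makes all of them non-negative,
    and z^-N makes all of them strictly negative. *)
Lemma trig_dense x (d : R) : 0 < d -> exists p (N : nat),
  [/\ `|x - p| <= d, H2 (mulL2 (fun z => sval z ^ N%:Z) p) &
      H2perp (mulL2 (fun z => sval z ^ (- N%:Z)) p)].
Proof.
move=> d0; have [y [y' [hy hy' e happ]]] := H2_decomposition x.
have [|N [hN hN']] := happ (d / 2); first by rewrite divr_gt0.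
have zN (m : int) := ess_bounded_zpow R m.
exists (trig_sum x N), N; split.
- rewrite {1}e /trig_sum opprD addrACA (le_trans (ler_normD _ _))// [leRHS]splitr.
  by rewrite lerD// distrC.
- rewrite (mulL2D _ _ (zN _)) !(mulL2_sum _ (zN _)); apply: H2D; apply: H2_sum => k;
    rewrite (mulL2Z _ _ (zN _)) mulL2_zpow_chi; apply: H2Z; apply: H2_chi => //.
  by rewrite NegzE subr_ge0 lez_nat.
- rewrite (mulL2D _ _ (zN _)) !(mulL2_sum _ (zN _)); apply: H2perpD; apply: H2perp_sum => k;
    rewrite (mulL2Z _ _ (zN _)) mulL2_zpow_chi; apply: H2perpZ; apply: H2perp_chi.
    by rewrite addrC subr_lt0 ltz_nat.
  by rewrite NegzE -opprD oppr_lt0 ltr_wpDl.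
Qed.

End FourierSeries.

(** * Block operators *)

Section BlockOperators.
Variable R : realType.
Implicit Types (V W : set (L2 R)) (A S P Q U : L2 R -> L2 R).

Lemma bounded_operator_cst V A : bounded_operator V A ->
  exists2 k : R, 0 <= k & forall x, V x -> `|A x| <= k * `|x|.
Proof.
move=> [_ _ [k hk]]; exists `|k| => // x /hk/le_trans; apply.
by rewrite ler_wpM2r// ler_norm.
Qed.

Lemma invertible_ext V A B : (forall x, V x -> A x = B x) -> invertible V A -> invertible V B.
Proof.
move=> AB [S bS AS]; exists S => // x Vx; have [SV _ _] := bS.
by rewrite -!AB//; [exact: AS|exact: SV].
Qed.

(** What the block arguments use of [H2] and [H2perp]; being symmetric, it lets each argument serve
    for either order of the summands. *)
Record splitting V W P Q : Prop := Splitting {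
  split_V : forall x, V (P x);
  split_W : forall x, W (Q x);
  split_lin : forall (a : R[i]) x y,
    P (a *: x + y) = a *: P x + P y /\ Q (a *: x + y) = a *: Q x + Q y;
  split_add : forall x, P x + Q x = x;
  split_PV : forall x, V x -> P x = x /\ Q x = 0;
  split_PW : forall x, W x -> P x = 0 /\ Q x = x;
  split_norm : forall x, `|P x| <= `|x| /\ `|Q x| <= `|x| }.

Lemma splitting_sym V W P Q : splitting V W P Q -> splitting W V Q P.
Proof.
case=> h1 h2 h3 h4 h5 h6 h7; split => //.
- by move=> a x y; have [] := h3 a x y.
- by move=> x; rewrite addrC.
- by move=> x /h6[].
- by move=> x /h5[].
- by move=> x; have [] := h7 x.
Qed.

Lemma splitting_H2 : splitting (@H2 R) (@H2perp R) (@projH2 R) (@projH2perp R).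
Proof.
split.
- by move=> x; have [] := projH2P x.
- by move=> x; have [] := projH2P x.
- by move=> a x y; exact: projH2_lin.
- exact: projH2_projH2perp.
- by move=> x; exact: projH2_id.
- by move=> x; exact: projH2_H2perp.
- exact: projH2_norm.
Qed.

Section Splitting.
Variables (V W : set (L2 R)) (P Q : L2 R -> L2 R).
Hypothesis sp : splitting V W P Q.

Lemma split_PD x y : P (x + y) = P x + P y.
Proof. by have [] := split_lin sp 1 x y; rewrite !scale1r. Qed.

Lemma split_QD x y : Q (x + y) = Q x + Q y.
Proof. by have [] := split_lin sp 1 x y; rewrite !scale1r. Qed.

Lemma operatorD A x y : bounded_operator setT A -> A (x + y) = A x + A y.
Proof. by move=> [_ lA _]; have := lA 1 x y I I; rewrite !scale1r. Qed.

(* Block-triangular inversion: with [v := A_V^-1 (P y)] the equation [A x = y]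
   is solved by [x = v + A_W^-1 (Q y - Q (A v))]. *)
Lemma invertible_triangular A : bounded_operator setT A ->
  (forall w, W w -> W (A w)) ->
  invertible V (fun v => P (A v)) -> invertible W (fun w => Q (A w)) ->
  invertible setT A.
Proof.
move=> bA AW [S bS SP] [S' bS' SQ].
have [_ lA _] := bA; have [k k0 hk] := bounded_operator_cst bA.
have [SV lS _] := bS; have [s s0 hs] := bounded_operator_cst bS.
have [SW lS' _] := bS'; have [s' s'0 hs'] := bounded_operator_cst bS'.
have [PV PW PL PQ PVV PWW Pn] := sp.
pose v y := S (P y).
have Vv y : V (v y) by exact: SV.
have v_lin a x y : v (a *: x + y) = a *: v x + v y.
  by rewrite /v (PL a x y).1 lS.
have vn y : `|v y| <= s * `|y|.
  by rewrite (le_trans (hs _ (PV y)))// ler_wpM2l// (Pn y).1.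
pose w y := S' (Q (y - A (v y))).
have Ww y : W (w y) by exact: SW.
have w_lin a x y : w (a *: x + y) = a *: w x + w y.
  rewrite /w v_lin lA// opprD addrACA -scalerBr (PL a _ _).2 lS'//; exact: PW.
have wn y : `|w y| <= s' * (1 + k * s) * `|y|.
  rewrite (le_trans (hs' _ (PW _)))// -mulrA ler_wpM2l// (le_trans (Pn _).2)//.
  rewrite mulrDl mul1r (le_trans (ler_normB _ _))// lerD2l -mulrA.
  by rewrite (le_trans (hk _ I))// ler_wpM2l.
exists (fun y => v y + w y).
  split=> //.
  - by move=> a x y _ _; rewrite v_lin w_lin scalerDr addrACA.
  - exists (s + s' * (1 + k * s)) => x _.
    by rewrite mulrDl (le_trans (ler_normD _ _))// lerD.
move=> x _; split.
(* As [A] preserves [W], the component of [A x] along [V] depends on [P x] alone. *)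
- have PA : P (A x) = P (A (P x)).
    by rewrite -{1}(PQ x) operatorD// split_PD (PWW _ (AW _ (PW x))).1 addr0.
  have vE : v (A x) = P x by rewrite /v PA (SP _ (PV x)).1.
  have AE : A x - A (P x) = A (Q x).
    by rewrite -{1}(PQ x) operatorD// addrAC subrr add0r.
  by rewrite vE /w vE AE (SQ _ (PW x)).1 PQ.
- rewrite operatorD// -[LHS]PQ !split_PD !split_QD.
  rewrite (PWW _ (AW _ (Ww x))).1 addr0 (SP _ (PV x)).2.
  rewrite (SQ _ (PW _)).2 (_ : Q (x - A (v x)) = Q x - Q (A (v x))); last first.
    by have := (PL (-1) (A (v x)) x).2; rewrite !scaleN1r addrC => ->; rewrite addrC.
  by rewrite [X in P x + X]addrC subrK PQ.
Qed.

(** When the inverse preserves [W] as well, both operators are triangular in the same sense, so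
    their blocks on [V] multiply to the identity in either order. *)
Lemma invertible_compression A U : bounded_operator setT A ->
  bounded_operator setT U -> (forall x, U (A x) = x /\ A (U x) = x) ->
  (forall w, W w -> W (A w)) -> (forall w, W w -> W (U w)) ->
  invertible V (fun v => P (A v)).
Proof.
move=> bA bU UA AW UW; have [PV PW PL PQ PVV PWW Pn] := sp.
have [_ lU [k hk]] := bU.
have key B C x : bounded_operator setT B -> (forall w, W w -> W (B w)) ->
    B (C x) = x -> V x -> P (B (P (C x))) = x.
  move=> bB BW BC Vx.
  have : P (B (P (C x) + Q (C x))) = x by rewrite PQ BC (PVV _ Vx).1.
  by rewrite operatorD// split_PD (PWW _ (BW _ (PW _))).1 addr0.
exists (fun v => P (U v)).
  split.
  - by move=> x _; exact: PV.
  - by move=> a x y _ _; rewrite lU// (PL a _ _).1.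
  - by exists k => x _; rewrite (le_trans (Pn _).1)// hk.
by move=> x Vx; have [h1 h2] := UA x; split; [exact: (key U A)|exact: (key A U)].
Qed.

(** For w in W, A is diagonal and so sends the component P(U w) to P(A(U w)) = P w = 0; injectivity
    of A gives P(U w) = 0. *)
Lemma inverse_invariant A U : bounded_operator setT A -> bounded_operator setT U ->
  (forall x, U (A x) = x /\ A (U x) = x) ->
  (forall v, V v -> V (A v)) -> (forall w, W w -> W (A w)) ->
  forall w, W w -> W (U w).
Proof.
move=> bA bU UA AV AW w Ww; have [PV PW PL PQ PVV PWW Pn] := sp.
have : P (A (P (U w) + Q (U w))) = 0 by rewrite PQ (UA w).2 (PWW _ Ww).1.
rewrite operatorD// split_PD (PWW _ (AW _ (PW _))).1 addr0 (PVV _ (AV _ (PV _))).1 => APU0.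
have A0 : A 0 = 0 by have := operatorD 0 0 bA; rewrite addr0 => /eqP;
  rewrite -subr_eq subrr eq_sym => /eqP.
have PU0 : P (U w) = 0.
  by rewrite -(UA (P (U w))).1 APU0 -[in LHS]A0 (UA 0).1.
by rewrite -(PQ (U w)) PU0 add0r; exact: PW.
Qed.

(** An inverse of [A] acts on [W] as 1/l and so preserves it, which permits compression to [V].
    Conversely, the block on [W] is inverted by 1/l and triangular inversion applies. *)
Lemma invertible_scalar_block A (l : R[i]) : bounded_operator setT A ->
  (forall c w, W w -> W (c *: w)) -> l != 0 -> (forall w, W w -> A w = l *: w) ->
  invertible setT A <-> invertible V (fun v => P (A v)).
Proof.
move=> bA Wc l0 Al; have AW w : W w -> W (A w) by move=> Ww; rewrite Al//; exact: Wc.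
have [PV PW PL PQ PVV PWW Pn] := sp.
split=> [[U bU UA]|iV].
  have {}UA x : U (A x) = x /\ A (U x) = x by exact: UA.
  apply: (invertible_compression bA bU UA AW) => w Ww.
  have -> : w = A (l^-1 *: w) by rewrite Al ?scalerA ?mulfV ?scale1r//; exact: Wc.
  by rewrite (UA _).1; exact: Wc.
apply: invertible_triangular => //; exists (fun w => l^-1 *: w).
  split; first by move=> w; exact: Wc.
    by move=> a x y _ _; rewrite scalerDr !scalerA mulrC.
  by exists (normc l^-1) => x _; rewrite L2Z_norm.
move=> w Ww; have Wlw : W (l^-1 *: w) by exact: Wc.
have AE x : W x -> Q (A x) = l *: x by move=> Wx; rewrite (PWW _ (AW _ Wx)).2 Al.
by rewrite !AE// !scalerA mulfV// mulVf// scale1r.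
Qed.

Lemma not_invertible_kernel A w : bounded_operator setT A -> A w = 0 -> w != 0 ->
  ~ invertible setT A.
Proof.
move=> bA Aw /eqP w0 [U bU UA]; apply: w0.
have UwA : U (A w) = w by exact: (UA w I).1.
have U0 : U (A w) = U (A w) + U (A w) by rewrite -operatorD// Aw addr0.
by rewrite -UwA; apply: (addrI (U (A w))); rewrite -U0 addr0.
Qed.

End Splitting.

End BlockOperators.

(** * Spectra of singular integral operators *)

Section SingularOperator.
Variable R : realType.
Implicit Types (x y v w : L2 R) (l : R[i]) (T : L2 R -> L2 R).
Local Notation mu := (@mcircle R).

Lemma bounded_operator_shift T l : bounded_operator setT T ->
  bounded_operator setT (fun x => T x - l *: x).
Proof.
move=> [_ lT [k hk]]; split=> //.
- by move=> a x y _ _; rewrite lT// scalerDr opprD addrACA scalerBr !scalerA mulrC.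
- exists (k + normc l) => x _; rewrite mulrDl (le_trans (ler_normB _ _))// L2Z_norm.
  by rewrite lerD2r; exact: hk.
Qed.

Section Fixed.
Variables (alpha beta : circle R -> R[i]) (Ma Mb : R).
Hypotheses (ba : ess_bounded alpha Ma) (bb : ess_bounded beta Mb).

Lemma bounded_singular_op : bounded_operator setT (singular_op alpha beta).
Proof.
split=> //.
- move=> a x y _ _; rewrite /singular_op (projH2_lin _ _ _).1 (projH2_lin _ _ _).2.
  rewrite (mulL2D _ _ ba) (mulL2D _ _ bb) (mulL2Z _ _ ba) (mulL2Z _ _ bb).
  by rewrite scalerDr addrACA.
- exists (`|Ma| + `|Mb|) => x _; rewrite mulrDl (le_trans (ler_normD _ _))//.
  have h f M y : ess_bounded f M -> `|y| <= `|x| -> `|mulL2 f y| <= `|M| * `|x|.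
    move=> fM yx; rewrite (le_trans (mulL2_norm _ fM))//.
    by apply: (@le_trans _ _ (`|M| * `|y|)); rewrite ?ler_wpM2r ?ler_wpM2l ?ler_norm.
  by have [h1 h2] := projH2_norm x; rewrite lerD// h.
Qed.

Lemma singular_op_H2 v : H2 v -> singular_op alpha beta v = mulL2 alpha v.
Proof.
by move=> hv; have [h1 h2] := projH2_id hv; rewrite /singular_op h1 h2 (mulL20r bb) addr0.
Qed.

Lemma singular_op_H2perp w : H2perp w -> singular_op alpha beta w = mulL2 beta w.
Proof.
by move=> hw; have [h1 h2] := projH2_H2perp hw; rewrite /singular_op h1 h2 (mulL20r ba) add0r.
Qed.

Definition shifted l x : L2 R := singular_op alpha beta x - l *: x.

Lemma bounded_shifted l : bounded_operator setT (shifted l).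
Proof. exact/bounded_operator_shift/bounded_singular_op. Qed.

Lemma toeplitz_shifted l v : H2 v -> projH2 (shifted l v) = toeplitz alpha v - l *: v.
Proof.
move=> hv; rewrite /shifted singular_op_H2// addrC -scaleNr (projH2_lin _ _ _).1.
by rewrite (projH2_id hv).1 scaleNr addrC.
Qed.

Lemma co_toeplitz_shifted l w : H2perp w ->
  projH2perp (shifted l w) = co_toeplitz beta w - l *: w.
Proof.
move=> hw; rewrite /shifted singular_op_H2perp// addrC -scaleNr (projH2_lin _ _ _).2.
by rewrite (projH2_H2perp hw).2 scaleNr addrC.
Qed.

(** Reads T_alpha - l as the diagonal block on [H2] of the shifted operator, the form in which the
    block lemmas apply. *)
Lemma spectrum_toeplitzP l : spectrum (@H2 R) (toeplitz alpha) l <->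
  ~ invertible (@H2 R) (fun v => projH2 (shifted l v)).
Proof.
by split; apply: contra_not; apply: invertible_ext => v hv; rewrite toeplitz_shifted.
Qed.

Lemma spectrum_co_toeplitzP l : spectrum (@H2perp R) (co_toeplitz beta) l <->
  ~ invertible (@H2perp R) (fun w => projH2perp (shifted l w)).
Proof.
by split; apply: contra_not; apply: invertible_ext => w hw; rewrite co_toeplitz_shifted.
Qed.

Lemma shifted_H2 l v : analytic alpha -> H2 v -> H2 (shifted l v).
Proof.
move=> aa hv; rewrite /shifted singular_op_H2// addrC -scaleNr.
by apply: H2_lin => //; exact: mulL2_H2 ba aa hv.
Qed.

Lemma shifted_H2perp l w : coanalytic beta -> H2perp w -> H2perp (shifted l w).
Proof.
move=> cb hw; rewrite /shifted singular_op_H2perp// addrC -scaleNr.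
by apply: H2perp_lin => //; exact: mulL2_H2perp bb cb hw.
Qed.

Lemma spectrum_singular_sub : analytic alpha \/ coanalytic beta ->
  spectrum [set: L2 R] (singular_op alpha beta)
  `<=` spectrum (@H2 R) (toeplitz alpha) `|` spectrum (@H2perp R) (co_toeplitz beta).
Proof.
move=> ab l; apply: contra_notP => /not_orP[].
move=> /spectrum_toeplitzP/contrapT iT /spectrum_co_toeplitzP/contrapT iT'.
have bA := bounded_shifted l; case: ab => [aa|cb].
(* For analytic [alpha] the invariant summand is [H2], so the splitting is taken in reverse
   order. *)
- apply: (invertible_triangular (splitting_sym (splitting_H2 R)) bA) => // v.
  exact: shifted_H2.
- apply: (invertible_triangular (splitting_H2 R) bA) => // w.
  exact: shifted_H2perp.
Qed.

Lemma spectrum_singular_sup : analytic alpha -> coanalytic beta ->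
  spectrum (@H2 R) (toeplitz alpha) `|` spectrum (@H2perp R) (co_toeplitz beta)
  `<=` spectrum [set: L2 R] (singular_op alpha beta).
Proof.
move=> aa cb l hl [U bU UA']; have bA := bounded_shifted l.
have UA x : U (shifted l x) = x /\ shifted l (U x) = x by exact: UA'.
have AV v : H2 v -> H2 (shifted l v) by exact: shifted_H2.
have AW w : H2perp w -> H2perp (shifted l w) by exact: shifted_H2perp.
have sp := splitting_H2 R; have sp' := splitting_sym sp.
case: hl => [/spectrum_toeplitzP|/spectrum_co_toeplitzP]; apply.
- apply: (invertible_compression sp bA bU UA) => //.
  exact: (inverse_invariant sp bA bU UA).
- apply: (invertible_compression sp' bA bU UA) => //.
  exact: (inverse_invariant sp' bA bU UA).
Qed.

End Fixed.

Lemma ess_bounded0 : ess_bounded (fun=> 0 : R[i]) 0.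
Proof. by split; [exact: cmeasurable_cst|apply: nearW => z; rewrite normc0]. Qed.

Lemma chi_neq0 n : chi R n != 0.
Proof.
apply/eqP => c0; have := inner_chi R n n; rewrite c0 inner0l eqxx => /esym/eqP.
by rewrite oner_eq0.
Qed.

Lemma shifted_alpha0_H2perp alpha M l w : ess_bounded alpha M -> H2perp w ->
  shifted alpha (fun=> 0) l w = - l *: w.
Proof. by move=> ba hw; rewrite /shifted (singular_op_H2perp _ ba)// mulL20l sub0r scaleNr. Qed.

Lemma shifted_0beta_H2 beta M l v : ess_bounded beta M -> H2 v ->
  shifted (fun=> 0) beta l v = - l *: v.
Proof. by move=> bb hv; rewrite /shifted (singular_op_H2 _ bb)// mulL20l sub0r scaleNr. Qed.

Lemma spectrum_singular_alpha0 alpha M : ess_bounded alpha M ->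
  spectrum [set: L2 R] (singular_op alpha (fun=> 0))
    = spectrum (@H2 R) (toeplitz alpha) `|` [set 0].
Proof.
move=> ba; have b0 := ess_bounded0; rewrite predeqE => l.
have bA := bounded_shifted ba b0 l.
have [->|l0] := eqVneq l 0.
  split=> _; first by right.
  (* At l = 0 the operator vanishes on all of [H2perp]; z^-1 is a non-zero vector there. *)
  apply: (not_invertible_kernel (bounded_shifted ba b0 0) (w := chi R (-1))).
    by rewrite (shifted_alpha0_H2perp _ ba) ?oppr0 ?scale0r//; exact: H2perp_chi.
  exact: chi_neq0.
have E := invertible_scalar_block (splitting_H2 R) bA (@H2perpZ R)
  (ltac:(by rewrite oppr_eq0) : - l != 0) (fun w => @shifted_alpha0_H2perp _ _ l w ba).
split=> [hl|[/(spectrum_toeplitzP alpha b0) hl|/eqP]]; last by rewrite (negbTE l0).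
- by left; apply/(spectrum_toeplitzP alpha b0); apply: contra_not hl => /E.
- by apply: contra_not hl => /E.
Qed.

Lemma spectrum_singular_0beta beta M : ess_bounded beta M ->
  spectrum [set: L2 R] (singular_op (fun=> 0) beta)
    = spectrum (@H2perp R) (co_toeplitz beta) `|` [set 0].
Proof.
move=> bb; have b0 := ess_bounded0; rewrite predeqE => l.
have bA := bounded_shifted b0 bb l.
have [->|l0] := eqVneq l 0.
  split=> _; first by right.
  (* Here the kernel contains [H2], and the constant function 1 is a witness. *)
  apply: (not_invertible_kernel (bounded_shifted b0 bb 0) (w := chi R 0)).
    by rewrite (shifted_0beta_H2 _ bb) ?oppr0 ?scale0r//; exact: H2_chi.
  exact: chi_neq0.
have E := invertible_scalar_block (splitting_sym (splitting_H2 R)) bA (@H2Z R)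
  (ltac:(by rewrite oppr_eq0) : - l != 0) (fun w => @shifted_0beta_H2 _ _ l w bb).
split=> [hl|[/(spectrum_co_toeplitzP beta b0) hl|/eqP]]; last by rewrite (negbTE l0).
- by left; apply/(spectrum_co_toeplitzP beta b0); apply: contra_not hl => /E.
- by apply: contra_not hl => /E.
Qed.

(** * Approximate eigenvectors *)

Lemma mulL2_zpow_norm n x : `|mulL2 (fun z => sval z ^ n) x| = `|x|.
Proof.
have h := mulL2_ae x (ess_bounded_zpow R n).
by apply/eqP; rewrite eq_le; apply/andP; split; apply: le_L2_norm;
  apply: filterS h => z ->; rewrite normcM normc_zpow mul1r.
Qed.

Lemma mulL2_comm f g M N x : ess_bounded f M -> ess_bounded g N ->
  mulL2 f (mulL2 g x) = mulL2 g (mulL2 f x).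
Proof.
move=> bf bg; apply: L2_ae_eq.
apply: filterS3 (mulL2_ae (mulL2 g x) bf) (mulL2_ae (mulL2 f x) bg)
  (filterI (mulL2_ae x bf) (mulL2_ae x bg)) => z -> -> [-> ->].
by rewrite mulrCA.
Qed.

Lemma ess_boundedB f M l : ess_bounded f M ->
  ess_bounded (fun z : circle R => f z - l) (M + normc l).
Proof.
move=> [mf fM]; split; first exact: cmeasurableB (cmeasurable_cst _).
by apply: filterS fM => z fz; rewrite (le_trans (le_normcD _ _))// normcN lerD2r.
Qed.

Lemma mulL2_sub f M l x : ess_bounded f M ->
  mulL2 (fun z => f z - l) x = mulL2 f x - l *: x.
Proof.
move=> bf; apply: L2_ae_eq.
apply: filterS3 (mulL2_ae x (ess_boundedB l bf)) (ae_L2B (mulL2 f x) (l *: x))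
  (filterI (mulL2_ae x bf) (ae_L2Z l x)) => z -> -> [-> ->].
by rewrite mulrBl.
Qed.

Lemma essran_indicator f M l (e : R) : ess_bounded f M -> essran f l -> 0 < e ->
  exists2 x, x != 0 & `|mulL2 (fun z => f z - l) x| <= e * `|x|.
Proof.
move=> bf hl e0; have [mf _] := bf; have bg := ess_boundedB l bf; have [mg _] := bg.
pose E := [set z | normc (f z - l) < e].
have mE : measurable E.
  have := measurable_fun_ltr (cmeasurable_normc mg) (@measurable_cst _ _ (circle R) _ setT e).
  by move=> /(_ measurableT [set true] I); rewrite setTI.
have m1 : cmeasurable (fun z => (\1_E z)%:C : R[i]).
  by apply: cmeasurable_real; exact: measurable_indic.
have L1 : Lp 2%:E (fun z => (\1_E z)%:C : R[i]).
  apply: (@Lp2_bounded _ _ 1) => // z; rewrite normc_real indicE.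
  by case: (_ \in _); rewrite ?normr1 ?normr0.
have h1 := toL2_ae L1; exists (toL2 (fun z => (\1_E z)%:C)).
  apply/eqP => x0; have := hl e e0; rewrite -/E.
  suff -> : mu E = 0%E by rewrite ltxx.
  apply/negligibleP => //; have h0 := ae_L20 R.
  have : {ae mu, forall z, ~ E z}.
    rewrite -x0 in h0; apply: filterS2 h1 h0 => z -> /eqP.
    rewrite indicE; case: (boolP (z \in E)) => [_|/negP zE _]; last by rewrite inE in zE.
    by rewrite oner_eq0.
  by case=> N [mN N0 hN]; exists N; split => // z Ez; apply: hN => /=; apply.
set y := toL2 _; have -> : e * `|y| = `|e%:C *: y|.
  by rewrite L2Z_norm normc_real ger0_norm// ltW.
apply: le_L2_norm.
apply: filterS3 (mulL2_ae y bg) (ae_L2Z e%:C y) h1 => z -> -> ->.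
rewrite !normcM !normc_real (ger0_norm (ltW e0)) indicE.
case: (boolP (z \in E)) => [|_]; last by rewrite normr0 !mulr0.
by rewrite inE => /ltW h; rewrite ler_wpM2r.
Qed.

Lemma essran_trig f M l (e : R) : ess_bounded f M -> essran f l -> 0 < e ->
  exists p (N : nat), [/\ p != 0, `|mulL2 (fun z => f z - l) p| <= e * `|p|,
    H2 (mulL2 (fun z => sval z ^ N%:Z) p) & H2perp (mulL2 (fun z => sval z ^ (- N%:Z)) p)].
Proof.
move=> bf hl e0; have bg := ess_boundedB l bf; set g := fun z => f z - l in bg *.
pose K := `|M + normc l| + 1.
have K0 : 0 < K by rewrite ltr_wpDl.
have [x x0 hx] := essran_indicator bf hl (divr_gt0 e0 (ltr0n R 4)).
have nx : 0 < `|x| by rewrite normr_gt0.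
(* The first bound keeps the norm of [p] above half that of [x]; the second makes the error of the
   approximation, enlarged by at most [K], no more than e |x| / 4. Together with the e / 4 asked of
   the indicator the total is e |x| / 2 <= e |p|. *)
pose d := Num.min (`|x| / 2) (e * `|x| / (4 * K)).
have d0 : 0 < d by rewrite lt_min !divr_gt0 ?mulr_gt0.
have [p [N [hp h1 h2]]] := trig_dense x d0.
have [dx dK] : d <= `|x| / 2 /\ K * d <= e * `|x| / 4.
  split; first by rewrite ge_min lexx.
  apply: (@le_trans _ _ (K * (e * `|x| / (4 * K)))).
    by rewrite ler_wpM2l ?(ltW K0)// ge_min lexx orbT.
  by rewrite le_eqVlt; apply/orP; left; apply/eqP; field; rewrite gt_eqF.
have xp : `|x| / 2 <= `|p|.
  have := ler_normD (x - p) p; rewrite subrK => xxp.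
  rewrite -(lerD2l (`|x| / 2)) -splitr; apply: (le_trans xxp).
  by rewrite lerD2r; exact: le_trans hp dx.
exists p, N; split; [|idtac|exact: h1|exact: h2].
  by rewrite -normr_gt0; apply: lt_le_trans xp; rewrite divr_gt0.
have -> : mulL2 g p = mulL2 g x - mulL2 g (x - p).
  by rewrite (mulL2B _ _ bg) opprB addrC subrK.
have hK : `|mulL2 g (x - p)| <= K * d.
  rewrite (le_trans (mulL2_norm _ bg))//.
  apply: (@le_trans _ _ (K * `|x - p|)); last by rewrite ler_wpM2l ?(ltW K0).
  by rewrite ler_wpM2r// (le_trans (ler_norm _))// lerDl.
have ep : e * (`|x| / 2) <= e * `|p| by rewrite ler_wpM2l ?(ltW e0).
apply: (le_trans (ler_normB _ _)).
apply: (le_trans (lerD hx (le_trans hK dK))); apply: le_trans ep.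
by rewrite le_eqVlt; apply/orP; left; apply/eqP; field.
Qed.

(** Normalise the vector obtained for e = 1 / (n + 1). The normalising factors are real, hence the
    homogeneity asked for. *)
Lemma approx_spectrumP T l :
  (forall e : R, 0 < e -> exists2 h, h != 0 & `|T h - l *: h| <= e * `|h|) ->
  (forall (a : R) h, T (a%:C *: h) = a%:C *: T h) ->
  approx_spectrum [set: L2 R] T l.
Proof.
move=> H TZ.
have /choice[h hh] (n : nat) : exists h : L2 R, `|h| = 1 /\ `|T h - l *: h| <= n.+1%:R^-1.
  have [|y y0 hy] := H n.+1%:R^-1; first by rewrite invr_gt0.
  have ny : 0 < `|y| by rewrite normr_gt0.
  exists ((`|y|^-1)%:C *: y); split.
    by rewrite L2Z_norm normc_real ger0_norm ?invr_ge0// mulVf ?gt_eqF.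
  rewrite TZ scalerA mulrC -scalerA -scalerBr L2Z_norm normc_real ger0_norm ?invr_ge0//.
  by rewrite mulrC ler_pdivrMr.
exists h; split; first by move=> n; have [] := hh n.
apply: (@squeeze_cvgr _ _ _ _ (fun=> 0) (fun n => n.+1%:R^-1)).
- by apply: nearW => n; rewrite normr_ge0; have [] := hh n.
- exact: cvg_cst.
- exact: cvg_harmonic.
Qed.

Lemma essran_approx_spectrum alpha beta Ma Mb :
  ess_bounded alpha Ma -> ess_bounded beta Mb ->
  essran alpha `|` essran beta `<=` approx_spectrum [set: L2 R] (singular_op alpha beta).
Proof.
move=> ba bb l hl; apply: approx_spectrumP; last first.
  move=> a h; have [_ lin _] := bounded_singular_op ba bb.
  have S0 : singular_op alpha beta 0 = 0.
    by rewrite (singular_op_H2 _ bb (H2_0 R)) (mulL20r ba).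
  by have := lin a%:C h 0 I I; rewrite S0 !addr0.
have zb n := ess_bounded_zpow R n.
move=> e e0; case: hl => hl.
- have [p [N [p0 hp h1 _]]] := essran_trig ba hl e0.
  exists (mulL2 (fun z => sval z ^ N%:Z) p).
    by rewrite -normr_gt0 mulL2_zpow_norm normr_gt0.
  rewrite (singular_op_H2 _ bb h1) -(mulL2_sub _ _ ba).
  by rewrite (mulL2_comm _ (ess_boundedB l ba) (zb _)) !mulL2_zpow_norm.
- have [p [N [p0 hp _ h1]]] := essran_trig bb hl e0.
  exists (mulL2 (fun z => sval z ^ (- N%:Z)) p).
    by rewrite -normr_gt0 mulL2_zpow_norm normr_gt0.
  rewrite (singular_op_H2perp _ ba h1) -(mulL2_sub _ _ bb).
  by rewrite (mulL2_comm _ (ess_boundedB l bb) (zb _)) !mulL2_zpow_norm.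
Qed.

End SingularOperator.

Theorem theorem8p3 (R : realType) (alpha beta : circle R -> R[i])
    (halpha : Lp +oo%E alpha) (hbeta : Lp +oo%E beta) :
  [/\ essran alpha `|` essran beta
        `<=` approx_spectrum [set: L2 R] (singular_op alpha beta),
      spectrum [set: L2 R] (singular_op alpha (fun=> 0))
        = spectrum (@H2 R) (toeplitz alpha) `|` [set 0]
      /\ spectrum [set: L2 R] (singular_op (fun=> 0) beta)
        = spectrum (@H2perp R) (co_toeplitz beta) `|` [set 0],
      analytic alpha \/ coanalytic beta ->
        spectrum [set: L2 R] (singular_op alpha beta)
          `<=` spectrum (@H2 R) (toeplitz alpha)
               `|` spectrum (@H2perp R) (co_toeplitz beta) `|` [set 0] &
      analytic alpha -> coanalytic beta ->
        spectrum [set: L2 R] (singular_op alpha beta) `|` [set 0]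
          = spectrum (@H2 R) (toeplitz alpha)
            `|` spectrum (@H2perp R) (co_toeplitz beta) `|` [set 0] ].
Proof.
have [Ma ba] := Lpoo_bounded halpha; have [Mb bb] := Lpoo_bounded hbeta; split.
- exact: essran_approx_spectrum ba bb.
- split; [exact: spectrum_singular_alpha0 ba|exact: spectrum_singular_0beta bb].
- by move=> ab l /(spectrum_singular_sub ba bb ab); left.
- move=> aa cb; congr (_ `|` _); apply/seteqP; split.
    by apply: (spectrum_singular_sub ba bb); left.
  exact: (spectrum_singular_sup ba bb).
Qed.
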